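(* Let $d\ge2$ be an integer, $c=3-\sqrt2$, $\kappa>0$, $0<\Delta t<\pi/(c^2\kappa^2)$, and put $h=\kappa^2\Delta t/\pi$. Let $f(\mathbf{x},t)$, $\mathbf{x}\in\mathbb{R}^{d-1}$, be boundary data that is sufficiently smooth and decays sufficiently fast at infinity so that the Robin problem described in the context is well posed. Put $f_n=f(\cdot,n\Delta t)$, with $f_0\equiv0$. Then for any integer $N\ge1$, the solution $\sigma_0\equiv0,\sigma_1,\dots,\sigma_N$ of the forward Euler scheme for the Robin problem for the heat equation on the half space of $\mathbb{R}^d$ (defined in the context) satisfies $$\Big(\sum_{n=0}^N\|\sigma_n\|_{L^2(\mathbb{R}^{d-1})}^2\Big)^{1/2}\;\le\;\frac{2}{1-c\sqrt h}\,\Big(\sum_{n=0}^N\|f_n\|_{L^2(\mathbb{R}^{d-1})}^2\Big)^{1/2}.$$ That is, the forward Euler scheme is stable if $\Delta t<\pi/(c^2\kappa^2)$.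
   Context: On the half space with boundary identified with $\mathbb{R}^{d-1}$ and constant heat transfer coefficient $\kappa>0$, consider the heat equation $\partial u/\partial t=\Delta u$ with zero initial data, no volume forcing, and Robin condition $\partial u/\partial\bm\nu+\kappa u=f$ on the boundary, where $\bm\nu$ is the outward unit normal. Representing $u$ as a single layer heat potential with density $\sigma$ leads to the Volterra integral equation $$\sigma(\mathbf{x},t)+\frac{\kappa}{\sqrt\pi}\int_0^t\frac{1}{\sqrt{t-\tau}}\int_{\mathbb{R}^{d-1}}\frac{e^{-\frac{|\mathbf{x}-\mathbf{y}|^2}{4(t-\tau)}}}{(4\pi(t-\tau))^{(d-1)/2}}\,\sigma(\mathbf{y},\tau)\,d\mathbf{y}\,d\tau=2f(\mathbf{x},t),\qquad \mathbf{x}\in\mathbb{R}^{d-1}.$$ The forward Euler scheme takes $\sigma(\cdot,\tau)=\sigma_m$ for $\tau\in[m\Delta t,(m+1)\Delta t)$ and imposes, for $n=0,1,\dots,N$, $$\sigma_n(\mathbf{x})+\frac{\kappa}{\sqrt\pi}\sum_{m=0}^{n-1}\int_{m\Delta t}^{(m+1)\Delta t}\frac{1}{\sqrt{n\Delta t-\tau}}\int_{\mathbb{R}^{d-1}}\frac{e^{-\frac{|\mathbf{x}-\mathbf{y}|^2}{4(n\Delta t-\tau)}}}{(4\pi(n\Delta t-\tau))^{(d-1)/2}}\,\sigma_m(\mathbf{y})\,d\mathbf{y}\,d\tau=2f_n(\mathbf{x}).$$ *)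

(* Defs.v *)
From HB Require Import structures.
From mathcomp Require Import all_boot all_order all_algebra.
From mathcomp Require Import all_classical all_reals all_analysis.

Set Implicit Arguments.
Unset Strict Implicit.
Unset Printing Implicit Defensive.
Import Order.TTheory GRing.Theory Num.Theory.
Import numFieldNormedType.Exports.
Local Open Scope classical_set_scope.
Local Open Scope ring_scope.

(* Points of R^n are n-tuples: [n.-tuple R] carries the sigma-algebra
   generated by the coordinate projections, i.e. the Borel sets of R^n. *)

Section lebesgue_tuple.
Context (R : realType).

Definition tuple_consp n (p : n.-tuple R * R) : n.+1.-tuple R :=
  [tuple of p.2 :: p.1].

Lemma measurable_tuple_consp n : measurable_fun setT (@tuple_consp n).
Proof. exact: measurable_cons. Qed.

Definition lebesgue_step n (m : {measure set (n.-tuple R) -> \bar R}) :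
    set (n.+1.-tuple R) -> \bar R :=
  pushforward (m \x @lebesgue_measure R)%E (@tuple_consp n).

Section lebesgue_step_measure.
Context n (m : {measure set (n.-tuple R) -> \bar R}).

Let step0 : lebesgue_step m set0 = 0%E.
Proof. by rewrite /lebesgue_step /pushforward preimage_set0 measure0. Qed.

Let step_ge0 A : (0 <= lebesgue_step m A)%E.
Proof. by rewrite /lebesgue_step /pushforward. Qed.

Let step_sigma_additive : semi_sigma_additive (lebesgue_step m).
Proof.
have mc := @measurable_tuple_consp n.
move=> F mF tF mUF; rewrite /lebesgue_step /pushforward preimage_bigcup.
apply: measure_semi_sigma_additive.
- by move=> k; rewrite -[X in measurable X]setTI; exact: mc.
- apply/trivIsetP => /= i j _ _ ij; rewrite -preimage_setI.
  by move/trivIsetP : tF => /(_ _ _ _ _ ij) ->//; rewrite preimage_set0.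
- by rewrite -preimage_bigcup -[X in measurable X]setTI; exact: mc.
Qed.

HB.instance Definition _ := isMeasure.Build _ _ _ (lebesgue_step m)
  step0 step_ge0 step_sigma_additive.

End lebesgue_step_measure.

(* The n-fold product of the Lebesgue measure of R; R^0 is a point of mass 1. *)
Fixpoint lebesgue_tuple n : {measure set (n.-tuple R) -> \bar R} :=
  if n is n'.+1 then lebesgue_step (lebesgue_tuple n') else dirac [tuple].

Lemma lebesgue_tuple_box n (A : 'I_n -> set R) :
  (forall i, measurable (A i)) ->
  lebesgue_tuple n [set x | forall i, A i (tnth x i)] =
  (\prod_(i < n) lebesgue_measure (A i))%E.
Proof.
elim: n A => [|n IH] A mA.
  by rewrite big_ord0 /= diracE mem_set//= => -[].
rewrite big_ord_recl /= /lebesgue_step /pushforward.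
have -> : @tuple_consp n @^-1` [set x | forall i, A i (tnth x i)] =
    [set x | forall i, A (lift ord0 i) (tnth x i)] `*` A ord0.
  apply/seteqP; split=> [[x y] /= h|[x y] /= [h1 h2] i].
    split=> [i|]; last by have := h ord0.
    by have := h (lift ord0 i); rewrite /tuple_consp/= tnthS.
  by have [j ->|->//] := unliftP ord0 i; rewrite /tuple_consp tnthS.
have mB : measurable [set x : n.-tuple R |
    forall i, A (lift ord0 i) (tnth x i)].
  rewrite (_ : [set _ | _] = \bigcap_(i in [set: 'I_n])
      ((@tnth n R ^~ i) @^-1` A (lift ord0 i))).
    apply: fin_bigcap_measurable => // i _.
    by rewrite -[X in measurable X]setTI; exact: measurable_tnth.
  by apply/seteqP; split=> x /= h i; [move=> _; exact: h|exact: h].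
rewrite product_measure1E//=; last exact: mA.
rewrite (IH (fun i => A (lift ord0 i))) 1?muleC// => i; exact: mA.
Qed.

End lebesgue_tuple.

Section forward_euler.
Context (R : realType) (n : nat).
Implicit Types x y : n.-tuple R.

Definition sqdist x y : R := \sum_(i < n) (tnth x i - tnth y i) ^+ 2.

Definition heat_kernel (s : R) x y : R :=
  expR (- sqdist x y / (4 * s)) / (4 * pi * s) `^ (n%:R / 2).

(* [forward_euler_robin kappa dt N f sigma]: sigma_0, ..., sigma_N solve the
   forward Euler scheme with step [dt] and boundary data f_k = f(., k dt);
   here R^n is the boundary of the half space of R^(n+1). *)
Definition forward_euler_robin (kappa dt : R) (N : nat)
    (f : n.-tuple R -> R -> R) (sigma : nat -> n.-tuple R -> R) : Prop :=
  forall k, (k <= N)%N -> forall x,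
    sigma k x + kappa / Num.sqrt pi *
      (\sum_(m < k)
        \int[lebesgue_measure]_(tau in `[m%:R * dt, m.+1%:R * dt[)
          ((Num.sqrt (k%:R * dt - tau))^-1 *
           \int[lebesgue_tuple R n]_y
             (heat_kernel (k%:R * dt - tau) x y * sigma m y)))
    = 2 * f x (k%:R * dt).

Definition l2L2norm (N : nat) (g : nat -> n.-tuple R -> R) : \bar R :=
  ((\sum_(k < N.+1)
     'N[lebesgue_tuple R n]_2%:E [EFin \o g k] ^+ 2) `^ 2^-1)%E.

End forward_euler.

(* Main.v *)
(* Everything happens in the time domain. Let P_s be the heat semigroup of the
   boundary, phi_u(s) = <u, P_s u> and D = dt. Testing the scheme with sigma_n
   and summing gives, up to the factor kappa / sqrt pi, the cross terms
   sum_(m < n) int_0^D F_(n-m)(sigma_n, sigma_m) dtau with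
   F_l(u, v) = s^(-1/2) <u, P_s v> at s = l D - tau. The semigroup law and the
   Cauchy-Schwarz inequality make phi_u nonnegative and midpoint convex, hence
   convex and decreasing, and so is s^(-1/2) phi_u(s). Setting
   F_0 = 2 F_1 - F_2 keeps l |-> F_l convex, so the Toeplitz form
   sum_(m, n) F_|n-m|(sigma_n, sigma_m) is nonnegative, and the cross terms are
   bounded below by minus half of the integrated diagonal. By concavity of
   phi_u(0) - phi_u(s), the integral of 2 F_1 - F_2 is at most
   2 (3 - sqrt 2) sqrt D |u|^2. Hence (1 - c sqrt h) sum |sigma_n|^2 is at most
   2 sum <f_n, sigma_n>, and Young's inequality concludes. *)

(* The scheme is explicit, so its cross terms contain no diagonal: lag 0 would evaluate the kernel
   at s = -tau, where it has no meaning. A positive Toeplitz form needs a diagonal all the same, and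
   linear extrapolation is the smallest one that convexity allows. Its size is the whole loss: with
   phi_u frozen at |u|^2, the integral of 2 F_1 costs 4 sqrt D |u|^2 and that of F_2 gives back 2
   (sqrt 2 - 1) sqrt D |u|^2; half of the difference is c sqrt D |u|^2.

   The F_l are bilinear forms, not numbers. Instead of diagonalizing the semigroup by a Fourier
   transform, the argument decomposes the dependence on the lag into weights that count windows of
   indices. On a window the double sum of F_l is F_l(W, W) for a single function W, the sum of
   sigma_i over the window, so scalar convexity for each fixed W is enough.

   Besides measurability, the semigroup enters through four properties of the kernel: nonnegativity,
   symmetry, mass one and the Chapman-Kolmogorov identity. *)
Require Import Defs.
From HB Require Import structures.
From mathcomp Require Import all_boot all_order all_algebra.
From mathcomp Require Import all_classical all_reals all_analysis.
From mathcomp Require Import measurable_realfun.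
From mathcomp Require Import ring lra zify.

Set Implicit Arguments.
Unset Strict Implicit.
Unset Printing Implicit Defensive.
Import Order.TTheory GRing.Theory Num.Theory.
Import numFieldNormedType.Exports.
Local Open Scope classical_set_scope.
Local Open Scope ring_scope.

(** * Positivity of Toeplitz forms with convex coefficients *)

Section toeplitz.
Context (R : realDomainType).

(** Positivity of the form on 0/1 vectors, weaker than semidefiniteness. Fejer weights only produce
    indicator vectors, and on these a form in the sigma_i reduces to one function, their sum over
    [P]. *)
Definition window_ge0 n (b : nat -> nat -> R) :=
  forall P : pred nat, 0 <= \sum_(i < n | P i) \sum_(j < n | P j) b i j.

Definition ndist (i j : nat) : nat := (i - j) + (j - i).

Lemma sum_itv M a b :
  (\sum_(p < M) ((a <= p) && (p < b)) = minn b M - a)%N.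
Proof.
elim: M => [|M IH]; first by rewrite big_ord0; lia.
rewrite big_ord_recr /= IH.
by case: (leqP a M); case: (ltnP M b); lia.
Qed.

(* The Fejer weight [K - |i - j|] counts the windows of length [K] that
   contain both [i] and [j]. *)
Lemma fejer_sum_ge0 n K (b : nat -> nat -> R) : window_ge0 n b ->
  0 <= \sum_(i < n) \sum_(j < n) (K - ndist i j)%:R * b i j.
Proof.
move=> bge0; pose W p : pred nat := fun i => (i <= p < i + K)%N.
have -> : \sum_(i < n) \sum_(j < n) (K - ndist i j)%:R * b i j =
    \sum_(p < n + K) \sum_(i < n | W p i) \sum_(j < n | W p j) b i j.
  transitivity (\sum_(i < n) \sum_(j < n) \sum_(p < n + K)
     (W p i && W p j)%:R * b i j).
    apply: eq_bigr => i _; apply: eq_bigr => j _.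
    rewrite -mulr_suml -natr_sum; congr (_%:R * _).
    transitivity (\sum_(p < n + K)
      ((maxn i j <= p) && (p < minn i j + K)))%N.
      by rewrite sum_itv /ndist; have := ltn_ord i; have := ltn_ord j; lia.
    by apply: eq_bigr => p _; rewrite /W; congr nat_of_bool; lia.
  under eq_bigr do rewrite exchange_big/=.
  rewrite exchange_big/=; apply: eq_bigr => p _.
  rewrite [RHS]big_mkcond/=; apply: eq_bigr => i _.
  case: ifPn => Wi; last by rewrite big1// => j _; rewrite mul0r.
  rewrite [RHS]big_mkcond/=; apply: eq_bigr => j _.
  by case: ifPn => _; rewrite ?mul1r ?mul0r.
by apply: sumr_ge0 => p _; exact: bge0.
Qed.

(** Summation by parts twice, from [M] back to [l]. Truncated subtraction kills the terms with k <
    l, so the range of the sum does not depend on [l], and the weight [k.+1 - l] at l = |i - j| is a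
    Fejer weight. *)
Lemma discrete_taylor (a : nat -> R) l M : (l <= M)%N ->
  a l = a M + (M - l)%:R * (a M - a M.+1) +
    \sum_(k < M) (k.+1 - l)%:R * (a k - a k.+1 *+ 2 + a k.+2).
Proof.
move=> /subnKC <-; set e := (M - l)%N; rewrite addKn.
elim: e => [|e IH].
  rewrite addn0 mul0r addr0 big1 ?addr0// => k _.
  by rewrite (_ : (k.+1 - l)%N = 0%N) ?mul0r//; have := ltn_ord k; lia.
rewrite {1}IH addnS big_ord_recr/=.
rewrite (_ : ((l + e).+1 - l)%N = e.+1); last by lia.
rewrite -natr1; ring.
Qed.

(* A nonnegative, decreasing, convex sequence is a nonnegative combination of
   Fejer weights, so its Toeplitz matrix is positive. *)
Lemma toeplitz_ge0 n (a : nat -> nat -> nat -> R) :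
  (forall l, window_ge0 n (a l)) ->
  (forall l, window_ge0 n (fun i j => a l i j - a l.+1 i j)) ->
  (forall l, window_ge0 n
     (fun i j => a l i j - a l.+1 i j *+ 2 + a l.+2 i j)) ->
  0 <= \sum_(i < n) \sum_(j < n) a (ndist i j) i j.
Proof.
move=> a0 a1 a2.
have -> : \sum_(i < n) \sum_(j < n) a (ndist i j) i j =
    \sum_(i < n) \sum_(j < n) a n i j +
    \sum_(i < n) \sum_(j < n) (n - ndist i j)%:R * (a n i j - a n.+1 i j) +
    \sum_(k < n) \sum_(i < n) \sum_(j < n) (k.+1 - ndist i j)%:R *
      (a k i j - a k.+1 i j *+ 2 + a k.+2 i j).
  rewrite [X in _ = _ + X]exchange_big/=.
  rewrite -!big_split/=; apply: eq_bigr => i _.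
  rewrite [X in _ = _ + X]exchange_big -!big_split/=; apply: eq_bigr => j _.
  apply: (discrete_taylor (fun l => a l i j)).
  by rewrite /ndist; have := ltn_ord i; have := ltn_ord j; lia.
rewrite !addr_ge0//.
- exact: (a0 n predT).
- exact: (fejer_sum_ge0 n (a1 n)).
- by apply: sumr_ge0 => k _; exact: (fejer_sum_ge0 k.+1 (a2 k)).
Qed.

End toeplitz.

(** * Bounded midpoint convex functions on the half line *)

Section midpoint_convex.
Context (R : realType) (phi : R -> R) (B : R).
Hypothesis phi_ge0 : forall s, 0 <= s -> 0 <= phi s.
Hypothesis phi_leB : forall s, 0 <= s -> phi s <= B.
Hypothesis phi_mid : forall s t, 0 <= s -> 0 <= t ->
  phi ((s + t) / 2) <= (phi s + phi t) / 2.

(** If [phi] rose from s to t, midpoint convexity would make each further step of length t - s rise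
    at least as much; this linear growth contradicts the bound [B]. *)
Lemma midconvex_nonincreasing s t : 0 <= s -> s <= t -> phi t <= phi s.
Proof.
move=> s0 st; rewrite leNgt; apply/negP => lt_phi.
pose D := t - s; have D0 : 0 <= D by rewrite subr_ge0.
pose p k := phi (s + k%:R * D).
have pos k : 0 <= s + k%:R * D by rewrite addr_ge0// mulr_ge0.
have step k : p k.+1 - p k >= phi t - phi s.
  elim: k => [|k IH].
    by rewrite /p mul1r mul0r addr0 /D addrC (addrC s) subrK addrC.
  apply: (le_trans IH).
  have := phi_mid (pos k) (pos k.+2).
  rewrite (_ : (_ + _) / 2 = s + k.+1%:R * D); last first.
    by rewrite -[k.+2%:R]natr1 -[k.+1%:R]natr1; field.
  by rewrite -/(p k) -/(p k.+1) -/(p k.+2); lra.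
have grow k : p k >= phi s + k%:R * (phi t - phi s).
  elim: k => [|k IH]; first by rewrite /p !mul0r !addr0.
  by rewrite -natr1; have := step k; lra.
have d0 : 0 < phi t - phi s by rewrite subr_gt0.
have B0 : 0 <= B / (phi t - phi s).
  by rewrite divr_ge0 ?(ltW d0)// (le_trans (phi_ge0 s0)) ?phi_leB.
have := archi_boundP B0; set k := Num.bound _.
rewrite ltr_pdivrMr// => Bk.
by have := grow k; have := phi_leB (pos k); have := phi_ge0 s0; rewrite /p; lra.
Qed.

(** Boundedness takes the place of continuity in passing from dyadic to real [theta]. *)
Lemma midconvex_chord t theta : 0 <= t -> 0 <= theta <= 1 ->
  phi (theta * t) <= (1 - theta) * phi 0 + theta * phi t.
Proof.
move=> t0; pose g u := phi (u * t) - (1 - u) * phi 0 - u * phi t.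
have B0 : 0 <= B by rewrite (le_trans (phi_ge0 t0)) ?phi_leB.
(* The excess over the chord vanishes at both ends, so midpoint convexity
   halves any upper bound on it. *)
have gk k : forall u, 0 <= u <= 1 -> g u <= B / 2 ^+ k.
  elim: k => [|k IH] u u01.
    rewrite expr0 divr1 /g.
    have := phi_leB (s := u * t); have := phi_ge0 (lexx 0); have := phi_ge0 t0.
    by move: u01 => /andP[u0 u1] ? ? /(_ (mulr_ge0 u0 t0)); nra.
  rewrite exprS invfM mulrCA mulrC.
  have [uh|uh] := leP u (1 / 2).
    have h : 0 <= u * 2 <= 1 by lra.
    have := IH _ h.
    have := phi_mid (s := 0) (t := u * 2 * t) (lexx _).
    rewrite (_ : (0 + _) / 2 = u * t); last by field.
    move=> /(_ _); rewrite /g; have : 0 <= u * 2 * t by rewrite mulr_ge0//; lra.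
    move=> ? /(_ _); lra.
  have h : 0 <= u * 2 - 1 <= 1 by lra.
  have := IH _ h.
  have := phi_mid (s := t) (t := (u * 2 - 1) * t) t0.
  rewrite (_ : (t + _) / 2 = u * t); last by field.
  rewrite /g; have : 0 <= (u * 2 - 1) * t by rewrite mulr_ge0//; lra.
  move=> ? /(_ _); lra.
move=> th; suff : g theta <= 0 by rewrite /g; lra.
rewrite leNgt; apply/negP => g0.
have Bg : 0 <= B / g theta by rewrite divr_ge0// ltW.
have := archi_boundP Bg; set k := Num.bound _.
rewrite ltr_pdivrMr// => Bk.
have := gk k _ th; rewrite ler_pdivlMr ?exprn_gt0// leNgt => /negP; apply.
apply: (lt_le_trans Bk); rewrite mulrC ler_pM2l//.
by rewrite -natrX ler_nat ltnW// ltn_expl.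
Qed.

End midpoint_convex.

(** * Convexity of the inverse square root and of products *)

Section inverse_sqrt.
Context (R : rcfType).

(** For the three roots a, b, c, the square b^2 is the mean of a^2 and c^2, hence ac <= b^2.
    Multiplied by 4ac <= (a + c)^2 this gives 2ac <= (a + c) b, which is the claim cleared of
    denominators. *)
Lemma invsqrt_convex (s D : R) : 0 < s -> 0 <= D ->
  (Num.sqrt (s + D))^-1 *+ 2 <= (Num.sqrt s)^-1 + (Num.sqrt (s + D *+ 2))^-1.
Proof.
move=> s0 D0.
have : 0 < Num.sqrt s by rewrite sqrtr_gt0.
have : 0 < Num.sqrt (s + D) by rewrite sqrtr_gt0; lra.
have : 0 < Num.sqrt (s + D *+ 2) by rewrite sqrtr_gt0; lra.
have : Num.sqrt s ^+ 2 = s by rewrite sqr_sqrtr//; lra.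
have : Num.sqrt (s + D) ^+ 2 = s + D by rewrite sqr_sqrtr//; lra.
have : Num.sqrt (s + D *+ 2) ^+ 2 = s + D *+ 2 by rewrite sqr_sqrtr//; lra.
move: (Num.sqrt s) (Num.sqrt (s + D)) (Num.sqrt _) => a b c c2 b2 a2 c0 b0 a0.
have acb : a * c <= b ^+ 2 by nra.
have acb2 : 2 * (a * c) <= (a + c) * b.
  rewrite -(ler_pXn2r (n := 2)) ?nnegrE//; [|nra|nra].
  rewrite !exprMn.
  have : 4 * (a * c) * (a * c) <= (a + c) ^+ 2 * b ^+ 2.
    by apply: ler_pM => //; [nra|nra|have := sqr_ge0 (a - c); nra].
  by nra.
rewrite (_ : a^-1 + c^-1 = (a + c) / (a * c)); last first.
  by field; rewrite !gt_eqF.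
by rewrite -mulr_natl ler_pdivrMr// mulrAC ler_pdivlMr ?mulr_gt0.
Qed.

(** Chebyshev: 2 (w0 p0 + w2 p2) = (w0 + w2)(p0 + p2) + (w0 - w2)(p0 - p2), where the first product
    is at least 4 w1 p1 and the second is nonnegative by monotonicity. *)
Lemma mul_convex (w0 w1 w2 p0 p1 p2 : R) :
  0 <= w2 -> w2 <= w1 -> w1 <= w0 -> w1 *+ 2 <= w0 + w2 ->
  0 <= p2 -> p2 <= p1 -> p1 <= p0 -> p1 *+ 2 <= p0 + p2 ->
  (w1 * p1) *+ 2 <= w0 * p0 + w2 * p2.
Proof.
move=> w20 w21 w10 w2c p20 p21 p10 p2c.
have : (w1 *+ 2) * (p1 *+ 2) <= (w0 + w2) * (p0 + p2).
  by apply: ler_pM => //; rewrite mulrn_wge0//; lra.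
have : 0 <= (w0 - w2) * (p0 - p2) by rewrite mulr_ge0//; lra.
by nra.
Qed.

End inverse_sqrt.

(** * Integrals of real-valued functions *)

Notation Rintegrable mu f := (mu.-integrable setT (EFin \o f)).

Section real_integral.
Context d (T : measurableType d) (R : realType).
Variable mu : {measure set T -> \bar R}.
Implicit Types f g : T -> R.

Lemma RintegrableP f : Rintegrable mu f -> measurable_fun setT f.
Proof. by move=> /integrableP[+ _] => /measurable_EFinP. Qed.

Lemma eq_Rintegrable f g : f =1 g -> Rintegrable mu f -> Rintegrable mu g.
Proof. by move=> fg; apply: eq_integrable => //= x _; rewrite /= fg. Qed.

Lemma le_Rintegrable f g : measurable_fun setT f -> (forall x, `|f x| <= g x) ->
  Rintegrable mu g -> Rintegrable mu f.
Proof.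
move=> mf fg; apply: le_integrable => //; first exact/measurable_EFinP.
by move=> x _ /=; rewrite lee_fin (le_trans (fg x))// ler_norm.
Qed.

Lemma RintegrableD f g : Rintegrable mu f -> Rintegrable mu g ->
  Rintegrable mu (fun x => f x + g x).
Proof. by move=> fi gi; exact: (integrableD _ fi gi). Qed.

Lemma RintegrableZ a f : Rintegrable mu f -> Rintegrable mu (fun x => a * f x).
Proof. by move=> fi; exact: (integrableZl _ a fi). Qed.

Lemma Rintegrable_sum n (f : nat -> T -> R) (P : pred nat) :
  (forall i, (i < n)%N -> Rintegrable mu (f i)) ->
  Rintegrable mu (fun x => \sum_(i < n | P i) f i x).
Proof.
elim: n => [|n IH] fi.
  by apply: (@eq_Rintegrable (fun=> 0)) => [x|];
    [rewrite big_ord0|exact: integrable0].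
apply: (@eq_Rintegrable (fun x => \sum_(i < n | P i) f i x +
  (if P n then f n x else 0))) => [x|].
  by rewrite [RHS]big_mkcond big_ord_recr -big_mkcond.
apply: RintegrableD; first by apply: IH => i ni; exact/fi/ltnW.
by case: (P n); [exact: fi|exact: integrable0].
Qed.

Lemma Rintegral_sum n (f : nat -> T -> R) (P : pred nat) :
  (forall i, (i < n)%N -> Rintegrable mu (f i)) ->
  \int[mu]_x (\sum_(i < n | P i) f i x) = \sum_(i < n | P i) \int[mu]_x f i x.
Proof.
elim: n => [|n IH] fi.
  rewrite big_ord0 (@eq_Rintegral _ _ _ _ _ (cst 0)) ?Rintegral_cst ?mul0r//.
  by move=> x _; rewrite big_ord0.
rewrite [RHS]big_mkcond big_ord_recr -big_mkcond/= -IH => [|i ni]; last first.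
  exact/fi/ltnW.
have -> : (if P n then \int[mu]_x f n x else 0) =
    \int[mu]_x (if P n then f n x else 0).
  by case: (P n) => //; rewrite Rintegral_cst ?mul0r.
rewrite -RintegralD//.
- by apply: eq_Rintegral => x _;
    rewrite big_mkcond big_ord_recr -big_mkcond.
- by apply: Rintegrable_sum => i ni; exact/fi/ltnW.
- by case: (P n); [exact: fi|exact: integrable0].
Qed.

Lemma EFin_Rintegral f : Rintegrable mu f ->
  (\int[mu]_x f x)%:E = (\int[mu]_x (f x)%:E)%E.
Proof. by move=> fi; rewrite /Rintegral fineK//; exact: integrable_fin_num. Qed.

Lemma ge0_RintegrableP f : measurable_fun setT f -> (forall x, 0 <= f x) ->
  (\int[mu]_x (f x)%:E < +oo)%E -> Rintegrable mu f.
Proof.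
move=> mf f0 foo; apply/integrableP; split; first exact/measurable_EFinP.
by under eq_integral do rewrite /= ger0_norm//.
Qed.

Lemma ae_eq_Rintegral f g : measurable_fun setT f -> measurable_fun setT g ->
  {ae mu, forall x, f x = g x} -> \int[mu]_x f x = \int[mu]_x g x.
Proof.
move=> mf mg fg; congr fine; apply: ae_eq_integral => //.
- exact/measurable_EFinP.
- exact/measurable_EFinP.
- by apply: filterS fg => x /= -> _.
Qed.

Lemma Rintegral_cauchy_schwarz f g : Rintegrable mu (fun x => f x ^+ 2) ->
  Rintegrable mu (fun x => g x ^+ 2) -> Rintegrable mu (fun x => f x * g x) ->
  (\int[mu]_x (f x * g x)) ^+ 2 <=
  (\int[mu]_x (f x ^+ 2)) * (\int[mu]_x (g x ^+ 2)).
Proof.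
move=> ff gg fg.
set F := \int[mu]_x (f x ^+ 2); set G := \int[mu]_x (g x ^+ 2).
set H := \int[mu]_x (f x * g x).
have F0 : 0 <= F by apply: Rintegral_ge0 => x _; exact: sqr_ge0.
have G0 : 0 <= G by apply: Rintegral_ge0 => x _; exact: sqr_ge0.
have quad l : 0 <= F - 2 * l * H + l ^+ 2 * G.
  have -> : F - 2 * l * H + l ^+ 2 * G =
      \int[mu]_x ((f x - l * g x) ^+ 2).
    have i1 := RintegrableZ (- (2 * l)) fg; have i2 := RintegrableZ (l ^+ 2) gg.
    rewrite (_ : F - _ + _ = F + ((- (2 * l)) * H + l ^+ 2 * G)); last by ring.
    rewrite /H /G -!RintegralZl// -RintegralD// -RintegralD//; last first.
      exact: RintegrableD.
    by apply: eq_Rintegral => x _; ring.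
  by apply: Rintegral_ge0 => x _; exact: sqr_ge0.
have [G00|Gn0] := eqVneq G 0.
  suff -> : H = 0 by rewrite expr0n/= mulr_ge0.
  apply/eqP/negPn/negP => H0.
  (* For G = 0 the quadratic degenerates to F - 2 l H, which takes the value -1 at this [l]. *)
  have := quad ((F + 1) / (2 * H)); rewrite G00.
  rewrite (_ : _ + _ = - 1); last by field.
  by rewrite ler0N1.
have Gp : 0 < G by rewrite lt_neqAle eq_sym Gn0.
have := quad (H / G).
rewrite (_ : _ + _ = (F * G - H ^+ 2) / G); last by field.
by rewrite pmulr_lge0 ?invr_gt0// subr_ge0.
Qed.

End real_integral.

(** * Fubini's theorem for real-valued integrals *)

Section real_fubini.
Context d1 d2 (T1 : measurableType d1) (T2 : measurableType d2) (R : realType).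
Variables (m1 : {sigma_finite_measure set T1 -> \bar R}).
Variables (m2 : {sigma_finite_measure set T2 -> \bar R}).
Variable f : T1 * T2 -> R.
Hypothesis fi : (m1 \x m2)%E.-integrable setT (EFin \o f).

Lemma ae_Rintegrable1 :
  {ae m1, forall x, Rintegrable m2 (fun y => f (x, y))}.
Proof. exact: ae_integrable1 fi. Qed.

Lemma measurable_Rfubini1 :
  measurable_fun setT (fun x => \int[m2]_y f (x, y)).
Proof.
apply: measurableT_comp; first exact: fine_measurable.
exact: (measurable_fubini_F fi).
Qed.

Lemma measurable_Rfubini2 :
  measurable_fun setT (fun y => \int[m1]_x f (x, y)).
Proof.
apply: measurableT_comp; first exact: fine_measurable.
exact: (measurable_fubini_G fi).
Qed.

Lemma Rintegrable_fubini1 : Rintegrable m1 (fun x => \int[m2]_y f (x, y)).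
Proof.
apply: le_integrable (integrable_fubini_F fi) => //.
  by apply/measurable_EFinP; exact: measurable_Rfubini1.
move=> x _; rewrite /= /Rintegral /fubini_F.
by case: (integral _ _ _) => [r| |]//=; rewrite normr0 ?leey.
Qed.

(** Where a section is not integrable, [fine] replaces the inner integral by a default value; this
    happens only on a null set. *)
Lemma Rintegral12 :
  \int[m1]_x (\int[m2]_y f (x, y)) = \int[(m1 \x m2)%E]_z f z.
Proof.
congr fine; rewrite -(integral12_prod_meas1 fi).
apply: ae_eq_integral => //.
- by apply/measurable_EFinP; exact: measurable_Rfubini1.
- exact: (measurable_fubini_F fi).
- apply: filterS ae_Rintegrable1 => x fx _.
  exact: EFin_Rintegral.
Qed.

Lemma Rintegrable_fubini2 : Rintegrable m2 (fun y => \int[m1]_x f (x, y)).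
Proof.
have h : (\int[m2]_y `|fubini_G m1 (EFin \o f) y| < +oo)%E.
  apply: (@le_lt_trans _ _
      (\int[m2]_y (\int[m1]_x `|(EFin \o f) (x, y)|)))%E; last first.
    apply/(integrable21ltyP m1 m2); last exact: fi.
    exact: measurable_int fi.
  apply: ge0_le_integral => //.
  - by apply: measurableT_comp => //; exact: (measurable_fubini_G fi).
  - apply: (measurable_fun_fubini_tonelli_G (abse \o (EFin \o f))).
      by apply: measurableT_comp => //; exact: measurable_int fi.
    by move=> y; exact: abse_ge0.
  - move=> y _; apply: le_abse_integral => //.
    by apply: measurableT_comp => //; exact: measurable_int fi.
apply: (@le_integrable _ _ _ _ _ _ _ (fubini_G m1 (EFin \o f))) => //.
- by apply/measurable_EFinP; exact: measurable_Rfubini2.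
- move=> x _; rewrite /= /Rintegral /fubini_G.
  by case: (integral _ _ _) => [r| |]//=; rewrite normr0 ?leey.
- by apply/integrableP; split=> //; exact: (measurable_fubini_G fi).
Qed.

Lemma Rintegral21 :
  \int[m2]_y (\int[m1]_x f (x, y)) = \int[(m1 \x m2)%E]_z f z.
Proof.
congr fine; rewrite -(integral21_prod_meas1 fi).
apply: ae_eq_integral => //.
- by apply/measurable_EFinP; exact: measurable_Rfubini2.
- exact: (measurable_fubini_G fi).
- apply: filterS (ae_integrable2 fi) => x fx _.
  exact: EFin_Rintegral.
Qed.

End real_fubini.

(** * Square integrable functions and their inner product *)

Section square_integrable.
Context d (T : measurableType d) (R : realType).
Variable mu : {measure set T -> \bar R}.
Implicit Types u v : T -> R.

Definition L2 u :=
  measurable_fun setT u /\ Rintegrable mu (fun x => u x ^+ 2).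

Definition ip u v := \int[mu]_x (u x * v x).

Lemma L2_mul u v : L2 u -> L2 v -> Rintegrable mu (fun x => u x * v x).
Proof.
move=> [mu_ iu] [mv iv].
apply: (@le_Rintegrable _ _ _ _ _ (fun x => u x ^+ 2 + v x ^+ 2)).
- exact: measurable_funM.
- move=> x; rewrite ler_norml; apply/andP; split; nra.
- exact: RintegrableD.
Qed.

Lemma L2D u v : L2 u -> L2 v -> L2 (fun x => u x + v x).
Proof.
move=> u2 v2; have uv := L2_mul u2 v2; case: u2 v2 => mu_ iu [mv iv].
split; first exact: measurable_funD.
apply: (@eq_Rintegrable _ _ _ _
  (fun x => u x ^+ 2 + (2 * (u x * v x) + v x ^+ 2))).
  by move=> x /=; ring.
by apply: RintegrableD => //; apply: RintegrableD => //; exact: RintegrableZ.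
Qed.

Lemma L2Z a u : L2 u -> L2 (fun x => a * u x).
Proof.
move=> [mu_ iu]; split; first exact: measurable_funM.
apply: (@eq_Rintegrable _ _ _ _ (fun x => a ^+ 2 * u x ^+ 2)).
  by move=> x; rewrite exprMn.
exact: RintegrableZ.
Qed.

Lemma L2_0 : L2 (fun=> 0).
Proof.
split=> //; apply: (@eq_Rintegrable _ _ _ _ (cst 0)).
  by move=> x; rewrite expr0n.
exact: integrable0.
Qed.

Lemma L2_sum n (u : nat -> T -> R) (P : pred nat) :
  (forall i, (i < n)%N -> L2 (u i)) -> L2 (fun x => \sum_(i < n | P i) u i x).
Proof.
elim: n => [|n IH] u2.
  rewrite (_ : (fun x => _) = (fun=> 0)); first exact: L2_0.
  by apply/funext => x; rewrite big_ord0.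
rewrite (_ : (fun x => _) = (fun x => \sum_(i < n | P i) u i x +
    (if P n then u n x else 0))); last first.
  by apply/funext => x; rewrite big_mkcond big_ord_recr -big_mkcond.
apply: L2D; first by apply: IH => i ni; exact/u2/ltnW.
by case: (P n); [exact: u2|exact: L2_0].
Qed.

Lemma ipC u v : ip u v = ip v u.
Proof. by apply: eq_Rintegral => x _; rewrite mulrC. Qed.

Lemma ip_ge0 u : 0 <= ip u u.
Proof. by apply: Rintegral_ge0 => x _; rewrite -expr2 sqr_ge0. Qed.

Lemma ipDr u v v' : L2 u -> L2 v -> L2 v' ->
  ip u (fun x => v x + v' x) = ip u v + ip u v'.
Proof.
move=> u2 v2 v2'; rewrite /ip -RintegralD//; [|exact: L2_mul..].
by apply: eq_Rintegral => x _; rewrite mulrDr.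
Qed.

Lemma ipZr a u v : L2 u -> L2 v -> ip u (fun x => a * v x) = a * ip u v.
Proof.
move=> u2 v2; rewrite /ip -RintegralZl//; last exact: L2_mul.
by apply: eq_Rintegral => x _; rewrite mulrCA.
Qed.

Lemma ip_sumr n u (v : nat -> T -> R) (P : pred nat) : L2 u ->
  (forall i, (i < n)%N -> L2 (v i)) ->
  ip u (fun x => \sum_(i < n | P i) v i x) = \sum_(i < n | P i) ip u (v i).
Proof.
move=> u2 v2; rewrite /ip -(@Rintegral_sum _ _ _ mu n (fun i x => u x * v i x)).
  by apply: eq_Rintegral => x _; rewrite mulr_sumr.
by move=> i ni; apply: L2_mul => //; exact: v2.
Qed.

Lemma ip_suml n u (v : nat -> T -> R) (P : pred nat) : L2 u ->
  (forall i, (i < n)%N -> L2 (v i)) ->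
  ip (fun x => \sum_(i < n | P i) v i x) u = \sum_(i < n | P i) ip (v i) u.
Proof.
by move=> u2 v2; rewrite ipC ip_sumr//; apply: eq_bigr => i _; exact: ipC.
Qed.

Lemma ip_le_half u v : L2 u -> L2 v -> ip u v <= (ip u u + ip v v) / 2.
Proof.
move=> u2 v2.
have := ip_ge0 (fun x => u x + (-1) * v x).
have v2' := L2Z (-1) v2; have uv2 := L2D u2 v2'.
rewrite (ipDr uv2 u2 v2') (ipC _ u) (ipDr u2 u2 v2') (ipZr _ uv2 v2).
rewrite (ipC _ v) (ipDr v2 u2 v2') !ipZr// (ipC v u); lra.
Qed.

Lemma ae_eq_ip u v v' : measurable_fun setT u -> measurable_fun setT v ->
  measurable_fun setT v' -> {ae mu, forall x, v x = v' x} ->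
  ip u v = ip u v'.
Proof.
move=> mu_ mv mv' vv'; apply: ae_eq_Rintegral; try exact: measurable_funM.
by apply: filterS vv' => x ->.
Qed.

End square_integrable.

(* A fresh constant: the sigma-finiteness of [product_measure1] is not found by
   unification, being shadowed by the instance for probability measures. *)
Definition sfproduct d1 d2 (T1 : measurableType d1) (T2 : measurableType d2)
    (R : realType) (m1 : {sigma_finite_measure set T1 -> \bar R})
    (m2 : {sigma_finite_measure set T2 -> \bar R}) :
    set (T1 * T2) -> \bar R := (m1 \x m2)%E.

Section sfproduct_sigma_finite.
Context d1 d2 (T1 : measurableType d1) (T2 : measurableType d2) (R : realType).
Variables (m1 : {sigma_finite_measure set T1 -> \bar R}).
Variables (m2 : {sigma_finite_measure set T2 -> \bar R}).

HB.instance Definition _ := Measure.copy (sfproduct m1 m2) (m1 \x m2)%E.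

Let sfproduct_sigma_finite : sigma_finite setT (sfproduct m1 m2).
Proof.
have /sigma_finiteP[F [TF ndF Foo]] := sigma_finiteT m1.
have /sigma_finiteP[G [TG ndG Goo]] := sigma_finiteT m2.
exists (fun n => F n `*` G n).
  rewrite -setXTT TF TG predeqE => -[x y]; split; last first.
    by move=> [n _ []/= ? ?]; split; exists n.
  move=> [/= [n _ Fnx] [k _ Gky]]; exists (maxn n k) => //; split.
  - by move: x Fnx; exact/subsetPset/ndF/leq_maxl.
  - by move: y Gky; exact/subsetPset/ndG/leq_maxr.
move=> k; have [mF Fk] := Foo k; have [mG Gk] := Goo k.
split; first exact: measurableX.
by rewrite /sfproduct product_measure1E// lte_mul_pinfty// ge0_fin_numE.
Qed.

HB.instance Definition _ := Measure_isSigmaFinite.Build _ _ _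
  (sfproduct m1 m2) sfproduct_sigma_finite.

End sfproduct_sigma_finite.

(** Tonelli applies to the positive and the negative part separately; subtraction and [fine]
    preserve measurability even at points where the inner integral is infinite. *)
Lemma measurable_fun_Rintegral d1 d2 (T1 : measurableType d1)
    (T2 : measurableType d2) (R : realType)
    (m2 : {sigma_finite_measure set T2 -> \bar R}) (f : T1 * T2 -> R) :
  measurable_fun setT f -> measurable_fun setT (fun x => \int[m2]_y f (x, y)).
Proof.
move=> mf; have mEf : measurable_fun setT (EFin \o f) by exact/measurable_EFinP.
apply: measurableT_comp; first exact: fine_measurable.
have -> : (fun x => \int[m2]_y (f (x, y))%:E)%E =
  ((fun x => \int[m2]_y ((EFin \o f)^\+ (x, y))) \-
   (fun x => \int[m2]_y ((EFin \o f)^\- (x, y))))%E.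
  apply/funext => x; rewrite integralE; congr (_ - _)%E;
    by apply: eq_integral => y _; rewrite ?funeposE ?funenegE.
apply: emeasurable_funB.
- apply: (measurable_fun_fubini_tonelli_F (EFin \o f)^\+%E).
    exact: measurable_funepos.
  by move=> z; exact: funepos_ge0.
- apply: (measurable_fun_fubini_tonelli_F (EFin \o f)^\-%E).
    exact: measurable_funeneg.
  by move=> z; exact: funeneg_ge0.
Qed.

(** * The Schur test for nonnegative kernels *)

Section schur_test.
Context d1 d2 (T1 : measurableType d1) (T2 : measurableType d2) (R : realType).
Variables (m1 : {sigma_finite_measure set T1 -> \bar R}).
Variables (m2 : {sigma_finite_measure set T2 -> \bar R}).
Variables (k : T1 * T2 -> R) (C : R).
Hypotheses (mk : measurable_fun setT k) (k0 : forall z, 0 <= k z) (C0 : 0 < C).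
Hypothesis kC : forall x, (\int[m2]_y (k (x, y))%:E <= C%:E)%E.

Lemma schur_row_integrable u : L2 m1 u ->
  Rintegrable (m1 \x m2)%E (fun z => k z * u z.1 ^+ 2).
Proof.
move=> [mu_ iu].
have mku : measurable_fun setT (fun z : T1 * T2 => k z * u z.1 ^+ 2).
  by apply: measurable_funM => //; apply: measurable_funX;
    exact: measurableT_comp.
apply: ge0_RintegrableP => //.
  by move=> z; rewrite mulr_ge0// sqr_ge0.
rewrite (fubini_tonelli1 (fun z => (k z * u z.1 ^+ 2)%:E))//=; last 2 first.
- exact/measurable_EFinP.
- by move=> z; rewrite lee_fin mulr_ge0// sqr_ge0.
apply: (@le_lt_trans _ _ (\int[m1]_x (C * u x ^+ 2)%:E)%E); last first.
  have /integrableP[_] := RintegrableZ C iu.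
  apply: le_lt_trans; apply: ge0_le_integral => //=.
  - by move=> x _; rewrite lee_fin mulr_ge0 ?sqr_ge0// ltW.
  - exact: (measurable_int m1 (RintegrableZ C iu)).
  - do 2 apply: measurableT_comp => //.
    exact: (RintegrableP (RintegrableZ C iu)).
  - by move=> x _; rewrite lee_fin ler_norm.
apply: ge0_le_integral => //.
- by move=> x _; apply: integral_ge0 => y _; rewrite lee_fin mulr_ge0// sqr_ge0.
- apply: (measurable_fun_fubini_tonelli_F (fun z => (k z * u z.1 ^+ 2)%:E)).
    exact/measurable_EFinP.
  by move=> z; rewrite lee_fin mulr_ge0// sqr_ge0.
- exact: (measurable_int m1 (RintegrableZ C iu)).
- move=> x _; rewrite /fubini_F/=.
  under eq_integral do rewrite mulrC EFinM.
  rewrite ge0_integralZl//=.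
  + rewrite (mulrC C) (EFinM (u x ^+ 2)); apply: lee_wpmul2l; last exact: kC.
    by rewrite lee_fin sqr_ge0.
  + by apply/measurable_EFinP; exact: measurableT_comp.
  + by move=> y _; rewrite lee_fin.
  + by rewrite lee_fin sqr_ge0.
Qed.

Variable V : T2 -> R.
Hypothesis mV : measurable_fun setT V.
Hypothesis kV : Rintegrable (m1 \x m2)%E (fun z => k z * V z.2 ^+ 2).

Let A x := \int[m2]_y (k (x, y) * V y).

Lemma schur_integrable u : L2 m1 u ->
  Rintegrable (m1 \x m2)%E (fun z => k z * (u z.1 * V z.2)).
Proof.
move=> u2; have ku := schur_row_integrable u2.
apply: (@le_Rintegrable _ _ _ _ _
    (fun z => k z * u z.1 ^+ 2 + k z * V z.2 ^+ 2)).
- apply: measurable_funM => //; apply: measurable_funM.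
    by apply: measurableT_comp => //; exact: u2.1.
  by apply: measurableT_comp.
- move=> z; rewrite -mulrDr normrM ger0_norm// ler_wpM2l//.
  by rewrite ler_norml; apply/andP; split; nra.
- exact: RintegrableD.
Qed.

Lemma schur_row_fin x : Rintegrable m2 (fun y => k (x, y)).
Proof.
apply: ge0_RintegrableP => //; first exact: measurableT_comp.
by rewrite (le_lt_trans (kC x))// ltry.
Qed.

Lemma schur_section_integrable x :
  Rintegrable m2 (fun y => k (x, y) * V y ^+ 2) ->
  Rintegrable m2 (fun y => k (x, y) * V y).
Proof.
move=> kVx; apply: (@le_Rintegrable _ _ _ _ _
    (fun y => k (x, y) + k (x, y) * V y ^+ 2)).
- by apply: measurable_funM => //; exact: measurableT_comp.
- move=> y; rewrite -[X in X + _]mulr1 -mulrDr normrM ger0_norm// ler_wpM2l//.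
  by rewrite ler_norml; apply/andP; split; nra.
- by apply: RintegrableD => //; exact: schur_row_fin.
Qed.

Lemma schur_ae_integrable :
  {ae m1, forall x, Rintegrable m2 (fun y => k (x, y) * V y)}.
Proof.
apply: filterS (ae_Rintegrable1 kV) => x; exact: schur_section_integrable.
Qed.

Lemma schur_measurable : measurable_fun setT A.
Proof.
apply: (@measurable_fun_Rintegral _ _ _ _ _ m2 (fun z => k z * V z.2)).
by apply: measurable_funM => //; exact: measurableT_comp.
Qed.

(** Cauchy-Schwarz for the factors sqrt k and sqrt k * V, followed by the row bound. In extended
    reals the estimate holds at every [x], being trivial where the right side is infinite. *)
Lemma schur_pointwise x :
  ((A x ^+ 2)%:E <= C%:E * \int[m2]_y (k (x, y) * V y ^+ 2)%:E)%E.
Proof.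
have mkV : measurable_fun setT (fun y => k (x, y) * V y ^+ 2).
  by apply: measurable_funM; [exact: measurableT_comp|exact: measurable_funX].
have kV0 y : 0 <= k (x, y) * V y ^+ 2 by rewrite mulr_ge0// sqr_ge0.
have [fin|] := ltP (\int[m2]_y (k (x, y) * V y ^+ 2)%:E)%E +oo%E; last first.
  by rewrite leye_eq => /eqP ->; rewrite gt0_muley ?lte_fin// leey.
have iV : Rintegrable m2 (fun y => k (x, y) * V y ^+ 2).
  exact: ge0_RintegrableP.
have ikV := schur_section_integrable iV.
rewrite -EFin_Rintegral// -EFinM lee_fin.
have ikk := schur_row_fin x.
have cs := @Rintegral_cauchy_schwarz _ _ _ m2
  (fun y => Num.sqrt (k (x, y))) (fun y => Num.sqrt (k (x, y)) * V y).
have e1 : (fun y => Num.sqrt (k (x, y)) ^+ 2) = (fun y => k (x, y)).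
  by apply/funext => y; rewrite sqr_sqrtr.
have e2 : (fun y => (Num.sqrt (k (x, y)) * V y) ^+ 2) =
    (fun y => k (x, y) * V y ^+ 2).
  by apply/funext => y; rewrite exprMn sqr_sqrtr.
have e3 : (fun y => Num.sqrt (k (x, y)) * (Num.sqrt (k (x, y)) * V y)) =
    (fun y => k (x, y) * V y).
  by apply/funext => y; rewrite mulrA -expr2 sqr_sqrtr.
move: cs; rewrite e1 e2 e3 => /(_ ikk iV ikV) /le_trans; apply.
rewrite ler_wpM2r//; first exact: Rintegral_ge0.
by rewrite -lee_fin EFin_Rintegral.
Qed.

Lemma schur_L2 : L2 m1 A /\
  ip m1 A A <= C * \int[(m1 \x m2)%E]_z (k z * V z.2 ^+ 2).
Proof.
have mA := schur_measurable.
have mkV : measurable_fun setT (fun z => k z * V z.2 ^+ 2).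
  exact: RintegrableP kV.
have kV0 z : 0 <= k z * V z.2 ^+ 2 by rewrite mulr_ge0// sqr_ge0.
have h : (\int[m1]_x (A x ^+ 2)%:E <=
    C%:E * \int[(m1 \x m2)%E]_z (k z * V z.2 ^+ 2)%:E)%E.
  rewrite (fubini_tonelli1 (fun z => (k z * V z.2 ^+ 2)%:E))//=; last first.
    exact/measurable_EFinP.
  have mF := measurable_fun_fubini_tonelli_F (m2 := m2)
    (fun z => (k z * V z.2 ^+ 2)%:E) (measurableT_comp (@EFin_measurable R setT) mkV) kV0.
  rewrite -ge0_integralZl//; last 2 first.
  - by move=> x _; apply: integral_ge0 => y _; rewrite lee_fin.
  - by rewrite lee_fin ltW.
  apply: ge0_le_integral => //.
  - by move=> x _; rewrite lee_fin sqr_ge0.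
  - by apply/measurable_EFinP; exact: measurable_funX.
  - exact: measurable_funeM.
  - by move=> x _; exact: schur_pointwise.
have A2 : Rintegrable m1 (fun x => A x ^+ 2).
  apply: ge0_RintegrableP; first exact: measurable_funX.
    by move=> x; exact: sqr_ge0.
  by apply: (le_lt_trans h); rewrite -EFin_Rintegral// -EFinM ltry.
split=> //; rewrite -lee_fin EFinM (EFin_Rintegral kV).
by apply: le_trans h; rewrite EFin_Rintegral.
Qed.

Lemma schur_ip u : L2 m1 u ->
  ip m1 u A = \int[(m1 \x m2)%E]_z (k z * (u z.1 * V z.2)).
Proof.
move=> u2; have iuV := schur_integrable u2; rewrite -(Rintegral12 iuV)/=.
apply: ae_eq_Rintegral.
- by apply: measurable_funM; [exact: u2.1|exact: schur_measurable].
- exact: measurable_Rfubini1 iuV.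
- apply: filterS schur_ae_integrable => x kx.
  by rewrite -RintegralZl//; apply: eq_Rintegral => y _; rewrite mulrCA.
Qed.

End schur_test.

(** Supplies the hypothesis [kV] of the Schur test. The column bound [b] varies with [y] because,
    for time averages, the column variable includes the time tau and the column mass is the
    unbounded weight [w tau]. *)
Lemma schur_col d1 d2 (T1 : measurableType d1) (T2 : measurableType d2)
    (R : realType) (m1 : {sigma_finite_measure set T1 -> \bar R})
    (m2 : {sigma_finite_measure set T2 -> \bar R})
    (k : T1 * T2 -> R) (b V : T2 -> R) :
  measurable_fun setT k -> (forall z, 0 <= k z) ->
  (forall y, (\int[m1]_x (k (x, y))%:E <= (b y)%:E)%E) ->
  measurable_fun setT V -> Rintegrable m2 (fun y => b y * V y ^+ 2) ->
  Rintegrable (m1 \x m2)%E (fun z => k z * V z.2 ^+ 2) /\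
  \int[(m1 \x m2)%E]_z (k z * V z.2 ^+ 2) <= \int[m2]_y (b y * V y ^+ 2).
Proof.
move=> mk k0 kb mV bV.
have mkV : measurable_fun setT (fun z : T1 * T2 => k z * V z.2 ^+ 2).
  by apply: measurable_funM => //; apply: measurable_funX;
    exact: measurableT_comp.
have kV0 z : 0 <= k z * V z.2 ^+ 2 by rewrite mulr_ge0// sqr_ge0.
have b0 y : 0 <= b y.
  by rewrite -lee_fin (le_trans _ (kb y))// integral_ge0// => x _; rewrite lee_fin.
have h : (\int[(m1 \x m2)%E]_z (k z * V z.2 ^+ 2)%:E <=
    \int[m2]_y (b y * V y ^+ 2)%:E)%E.
  rewrite (fubini_tonelli2 (fun z => (k z * V z.2 ^+ 2)%:E))//=; last first.
    exact/measurable_EFinP.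
  apply: ge0_le_integral => //.
  - by move=> y _; apply: integral_ge0 => x _; rewrite lee_fin.
  - apply: (measurable_fun_fubini_tonelli_G (fun z => (k z * V z.2 ^+ 2)%:E)) => //.
    exact/measurable_EFinP.
  - exact: (measurable_int m2 bV).
  - move=> y _; rewrite /fubini_G/=.
    under eq_integral do rewrite mulrC (EFinM (V y ^+ 2)).
    rewrite ge0_integralZl//=.
    + rewrite (mulrC (b y)) (EFinM (V y ^+ 2)); apply: lee_wpmul2l => //.
      by rewrite lee_fin sqr_ge0.
    + by apply/measurable_EFinP; exact: measurableT_comp.
    + by move=> x _; rewrite lee_fin.
    + by rewrite lee_fin sqr_ge0.
have ikV : Rintegrable (m1 \x m2)%E (fun z => k z * V z.2 ^+ 2).
  by apply: ge0_RintegrableP => //; rewrite (le_lt_trans h)// -EFin_Rintegral// ltry.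
by split=> //; rewrite -lee_fin !EFin_Rintegral.
Qed.

(** * Symmetric Markov semigroups and their energy *)

Section markov_semigroup.
Context d (T : measurableType d) (R : realType).
Variables (mu : {sigma_finite_measure set T -> \bar R}) (G : R -> T -> T -> R).
Hypothesis mG : measurable_fun setT (fun p : R * (T * T) => G p.1 p.2.1 p.2.2).
Hypothesis G0 : forall s x y, 0 <= G s x y.
Hypothesis Gsym : forall s x y, G s x y = G s y x.
Hypothesis G1 : forall s x, 0 < s -> (\int[mu]_y (G s x y)%:E = 1)%E.
Hypothesis GG : forall s t x y, 0 < s -> 0 < t ->
  (\int[mu]_z (G s x z * G t z y)%:E = (G (s + t) x y)%:E)%E.
Implicit Types u v : T -> R.

Definition smoothing s u x := \int[mu]_y (G s x y * u y).
Local Notation P := smoothing.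

Let mGc d' (X : measurableType d') (a : X -> R) (b c : X -> T) :
  measurable_fun setT a -> measurable_fun setT b -> measurable_fun setT c ->
  measurable_fun setT (fun z => G (a z) (b z) (c z)).
Proof.
move=> ma mb mc.
exact: (measurableT_comp mG (measurable_fun_pair ma (measurable_fun_pair mb mc))).
Qed.

Let mGs s : measurable_fun setT (fun z : T * T => G s z.1 z.2).
Proof. exact: mGc. Qed.

Let mGx s x : measurable_fun setT (G s x).
Proof. exact: (@mGc _ T (cst s) (cst x) id). Qed.

Let kerC s x : 0 < s -> (\int[mu]_y (G s x y)%:E <= 1%:E)%E.
Proof. by move=> s0; rewrite G1. Qed.

Let kerV s u : 0 < s -> L2 mu u ->
  Rintegrable (mu \x mu)%E (fun z => G s z.1 z.2 * u z.2 ^+ 2) /\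
  \int[(mu \x mu)%E]_z (G s z.1 z.2 * u z.2 ^+ 2) <= ip mu u u.
Proof.
move=> s0 [mu_ iu].
have [|||h1 h2] := @schur_col _ _ _ _ _ mu mu (fun z => G s z.1 z.2)
    (fun=> 1) u (mGs s) _ _ mu_ _; last split=> //.
- by move=> z.
- by move=> y /=; under eq_integral do rewrite Gsym; rewrite G1.
- by apply: eq_Rintegrable iu => x; rewrite mul1r.
- apply: (le_trans h2); rewrite le_eqVlt; apply/orP; left; apply/eqP.
  by apply: eq_Rintegral => x _; rewrite mul1r expr2.
Qed.

(** By symmetry and Chapman-Kolmogorov the squared norm is [G (s + s) x x]. Hence [smoothing s u x]
    is a convergent integral at every [x], not just almost everywhere. *)
Lemma kernel_L2 s x : 0 < s -> L2 mu (G s x).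
Proof.
move=> s0; split=> //; apply: ge0_RintegrableP.
- exact: measurable_funX.
- by move=> y; exact: sqr_ge0.
- rewrite (eq_integral (fun z => (G s x z * G s z x)%:E)).
    by rewrite GG// ltry.
  by move=> z _; rewrite (Gsym s z) expr2.
Qed.

Lemma smoothing_integrable s u x : 0 < s -> L2 mu u ->
  Rintegrable mu (fun y => G s x y * u y).
Proof. by move=> s0 u2; apply: L2_mul => //; exact: kernel_L2. Qed.

Lemma smoothing_L2 s u : 0 < s -> L2 mu u -> L2 mu (P s u).
Proof.
move=> s0 u2; have [ku _] := kerV s0 u2.
by have [] := schur_L2 (mGs s) (fun z => G0 s z.1 z.2) ltr01
  (fun x => kerC x s0) u2.1 ku.
Qed.

Lemma smoothing_contraction s u : 0 < s -> L2 mu u ->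
  ip mu (P s u) (P s u) <= ip mu u u.
Proof.
move=> s0 u2; have [ku kule] := kerV s0 u2.
have [_] := schur_L2 (mGs s) (fun z => G0 s z.1 z.2) ltr01
  (fun x => kerC x s0) u2.1 ku.
by rewrite mul1r => /le_trans; apply.
Qed.

Lemma smoothing_sym s u v : 0 < s -> L2 mu u -> L2 mu v ->
  ip mu u (P s v) = ip mu v (P s u).
Proof.
move=> s0 u2 v2; have [ku _] := kerV s0 u2; have [kv _] := kerV s0 v2.
rewrite (schur_ip (mGs s) (fun z => G0 s z.1 z.2) ltr01
  (fun x => kerC x s0) v2.1 kv u2).
have iuv := schur_integrable (mGs s) (fun z => G0 s z.1 z.2) ltr01
  (fun x => kerC x s0) v2.1 kv u2.
rewrite -(Rintegral21 iuv)/=; apply: eq_Rintegral => y _.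
rewrite /smoothing -RintegralZl//; last exact: smoothing_integrable.
by apply: eq_Rintegral => x _; rewrite Gsym; ring.
Qed.

Lemma smoothing_sum s n (u : nat -> T -> R) (Q : pred nat) x : 0 < s ->
  (forall i, (i < n)%N -> L2 mu (u i)) ->
  P s (fun y => \sum_(i < n | Q i) u i y) x = \sum_(i < n | Q i) P s (u i) x.
Proof.
move=> s0 u2; rewrite /smoothing.
rewrite -(@Rintegral_sum _ _ _ mu n (fun i y => G s x y * u i y)).
  by apply: eq_Rintegral => y _; rewrite mulr_sumr.
by move=> i ni; apply: smoothing_integrable => //; exact: u2.
Qed.

Lemma smoothingM s t u x : 0 < s -> 0 < t -> L2 mu u ->
  P s (P t u) x = P (s + t) u x.
Proof.
move=> s0 t0 u2; have st0 : 0 < s + t by rewrite addr_gt0.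
pose f (z : T * T) := G s x z.1 * (G t z.1 z.2 * u z.2).
have mf : measurable_fun setT f.
  apply: measurable_funM; first exact: measurableT_comp.
  by apply: measurable_funM => //; apply: measurableT_comp => //; exact: u2.1.
have inner y : (\int[mu]_z `|(f (z, y))%:E| = (G (s + t) x y * `|u y|)%:E)%E.
  rewrite (eq_integral (fun z => `|u y|%:E * (G s x z * G t z y)%:E)%E).
  2: by move=> z _; rewrite /f/= !normrM (ger0_norm (G0 _ _ _))
       (ger0_norm (G0 _ _ _)) -EFinM; congr EFin; ring.
  rewrite ge0_integralZl//=.
  - by rewrite GG// -EFinM mulrC.
  - apply/measurable_EFinP; apply: measurable_funM => //.
    exact: (@mGc _ T (cst t) id (cst y)).
  - by move=> z _; rewrite lee_fin mulr_ge0.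
have fi : Rintegrable (mu \x mu)%E f.
  apply/(integrable21ltyP mu mu); first exact/measurable_EFinP.
  rewrite (eq_integral (fun y => `|(G (s + t) x y * u y)%:E|)%E).
  2: by move=> y _; rewrite inner abse_EFin normrM (ger0_norm (G0 _ _ _)).
  by have /integrableP[_] := smoothing_integrable x st0 u2.
transitivity (\int[mu]_z (\int[mu]_y f (z, y))).
  apply: eq_Rintegral => z _; rewrite /smoothing -RintegralZl//.
  exact: smoothing_integrable.
rewrite (Rintegral12 fi) -(Rintegral21 fi); apply: eq_Rintegral => y _.
have iGG : Rintegrable mu (fun z => G s x z * G t z y).
  apply: ge0_RintegrableP.
  - apply: measurable_funM => //.
    exact: (@mGc _ T (cst t) id (cst y)).
  - by move=> z; rewrite mulr_ge0.
  - by rewrite GG// ltry.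
rewrite /f/=; under eq_Rintegral do rewrite mulrA.
by rewrite RintegralZr// /Rintegral GG.
Qed.

Definition energy s u v := ip mu u (P s v).
Local Notation q := energy.

Lemma energy_add s t u v : 0 < s -> 0 < t -> L2 mu u -> L2 mu v ->
  q (s + t) u v = ip mu (P s u) (P t v).
Proof.
move=> s0 t0 u2 v2; rewrite [RHS]ipC (smoothing_sym s0 _ u2)//; last first.
  exact: smoothing_L2.
by apply: eq_Rintegral => x _; rewrite smoothingM.
Qed.

Lemma energy_half s u : 0 < s -> L2 mu u ->
  q s u u = ip mu (P (s / 2) u) (P (s / 2) u).
Proof.
by move=> s0 u2; rewrite -energy_add ?divr_gt0//; congr (q _ u u); field.
Qed.

Lemma energy_sum s n (u : nat -> T -> R) (Q : pred nat) : 0 < s ->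
  (forall i, (i < n)%N -> L2 mu (u i)) ->
  let w := (fun y => \sum_(i < n | Q i) u i y) in
  q s w w = \sum_(i < n | Q i) \sum_(j < n | Q j) q s (u i) (u j).
Proof.
move=> s0 u2 w; have w2 : L2 mu w by exact: L2_sum.
rewrite /energy (@ip_suml _ _ _ mu n _ u)//; last exact: smoothing_L2.
apply: eq_bigr => i _.
rewrite -(@ip_sumr _ _ _ mu n (u i) (fun j => P s (u j)))//.
- by apply: eq_Rintegral => x _; rewrite smoothing_sum.
- exact: u2.
- by move=> j nj; apply: smoothing_L2 => //; exact: u2.
Qed.

(* [s |-> <u, P_s u>], extended by its limit at [s = 0]. *)
Definition energy0 u s := if 0 < s then q s u u else ip mu u u.

Lemma energy0_ge0 u s : L2 mu u -> 0 <= energy0 u s.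
Proof.
by move=> u2; rewrite /energy0; case: ifP => s0; rewrite ?energy_half// ip_ge0.
Qed.

Lemma energy0_le u s : L2 mu u -> energy0 u s <= ip mu u u.
Proof.
move=> u2; rewrite /energy0; case: ifP => s0; rewrite ?lexx//.
by rewrite energy_half// smoothing_contraction// divr_gt0.
Qed.

(** The energy at (s + t)/2 is the inner product of P_(s/2) u and P_(t/2) u, whose squared norms are
    the energies at s and t. When one of the times is 0, [u] itself stands for its smoothing. *)
Lemma energy0_mid u s t : L2 mu u -> 0 <= s -> 0 <= t ->
  energy0 u ((s + t) / 2) <= (energy0 u s + energy0 u t) / 2.
Proof.
move=> u2.
have half r : 0 < r -> L2 mu (P (r / 2) u).
  by move=> r0; apply: smoothing_L2 => //; rewrite divr_gt0.
have mid0 r : 0 < r -> q (r / 2) u u <= (ip mu u u + q r u u) / 2.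
  move=> r0; rewrite (energy_half r0)//; apply: ip_le_half => //; exact: half.
rewrite [0 <= s]le_eqVlt [0 <= t]le_eqVlt => /predU1P[<-|s0] /predU1P[<-|t0].
- by rewrite add0r mul0r /energy0 ltxx; lra.
- by rewrite add0r /energy0 ltxx t0 divr_gt0//; exact: mid0.
- by rewrite addr0 /energy0 ltxx s0 divr_gt0// addrC; exact: mid0.
rewrite /energy0 s0 t0 divr_gt0 ?addr_gt0//.
rewrite mulrDl energy_add ?divr_gt0// (energy_half s0)// (energy_half t0)//.
by apply: ip_le_half; exact: half.
Qed.

(** * Weighted time averages of the semigroup *)

Section time_average.
Variables (w r : R -> R) (C : R).
Hypotheses (mw : measurable_fun setT w) (mr : measurable_fun setT r).
Hypotheses (w0 : forall tau, 0 <= w tau).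
Hypotheses (r0 : forall tau, w tau != 0 -> 0 < r tau).
Hypotheses (C0 : 0 < C) (wi : Rintegrable (@lebesgue_measure R) w).
Hypothesis wC : \int[@lebesgue_measure R]_tau w tau <= C.
Local Notation leb := (@lebesgue_measure R).

Let nu : {sigma_finite_measure set (measurableTypeR R * T)%type -> \bar R} :=
  sfproduct leb mu.

(** Averaging in time and smoothing in space form one kernel operator from R * T to T, so that a
    single Schur test bounds both: the row mass is the integral of [w], the column mass is
    [w tau]. *)
Let k (z : T * (R * T)) := w z.2.1 * G (r z.2.1) z.1 z.2.2.

Let mk : measurable_fun setT k.
Proof.
have m21 : measurable_fun setT (fun z : T * (R * T) => z.2.1).
  exact: measurableT_comp.
apply: measurable_funM; first exact: measurableT_comp.
by apply: mGc => //; exact: measurableT_comp.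
Qed.

Let k0 z : 0 <= k z. Proof. by rewrite mulr_ge0. Qed.

Let wG tau x : (\int[mu]_y (w tau * G (r tau) x y)%:E = (w tau)%:E)%E.
Proof.
have [->|wn0] := eqVneq (w tau) 0.
  by under eq_integral do rewrite mul0r; rewrite integral0.
under eq_integral do rewrite EFinM.
rewrite ge0_integralZl//=.
- by rewrite G1 ?mule1//; exact: r0.
- exact/measurable_EFinP.
- by move=> y _; rewrite lee_fin.
- by rewrite lee_fin.
Qed.

Let kC x : (\int[nu]_p (k (x, p))%:E <= C%:E)%E.
Proof.
rewrite (@fubini_tonelli1 _ _ _ _ _ leb mu (fun p => (k (x, p))%:E))/=; last 2 first.
- by apply/measurable_EFinP; exact: measurableT_comp.
- by move=> p; rewrite lee_fin.
rewrite /fubini_F/=.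
under eq_integral do rewrite wG.
by rewrite -EFin_Rintegral// lee_fin.
Qed.

Let wv v : L2 mu v ->
  Rintegrable nu (fun p => w p.1 * v p.2 ^+ 2).
Proof.
move=> [mv iv].
have mwv : measurable_fun setT (fun p : R * T => w p.1 * v p.2 ^+ 2).
  by apply: measurable_funM; [exact: measurableT_comp|
    apply: measurable_funX; exact: measurableT_comp].
apply: ge0_RintegrableP => //.
  by move=> p; rewrite mulr_ge0// sqr_ge0.
rewrite (@fubini_tonelli1 _ _ _ _ _ leb mu
  (fun p => (w p.1 * v p.2 ^+ 2)%:E))/=; last 2 first.
- exact/measurable_EFinP.
- by move=> p; rewrite lee_fin mulr_ge0// sqr_ge0.
rewrite /fubini_F/=.
have e tau : (\int[mu]_y (w tau * v y ^+ 2)%:E =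
    (w tau * \int[mu]_y (v y ^+ 2))%:E)%E.
  by rewrite -RintegralZl// EFin_Rintegral//; exact: RintegrableZ.
under eq_integral do rewrite e mulrC.
by rewrite -EFin_Rintegral ?ltry//; exact: RintegrableZ.
Qed.

Let kV v : L2 mu v ->
  Rintegrable (mu \x nu)%E (fun z => k z * v z.2.2 ^+ 2).
Proof.
move=> v2.
have [] // := @schur_col _ _ _ _ _ mu nu k (fun p => w p.1)
  (fun p => v p.2) mk k0 _ _ (wv v2).
- move=> [tau y]; rewrite /k/=.
  by under eq_integral do rewrite Gsym; rewrite wG.
- by apply: measurableT_comp => //; exact: v2.1.
Qed.

Definition time_average v x := \int[leb]_tau (w tau * P (r tau) v x).

Let mv2 v : L2 mu v -> measurable_fun setT (fun p : R * T => v p.2).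
Proof. by move=> v2; apply: measurableT_comp => //; exact: v2.1. Qed.

Lemma measurable_smoothing v : L2 mu v ->
  measurable_fun setT (fun p : T * R => P (r p.2) v p.1).
Proof.
move=> v2; apply: (@measurable_fun_Rintegral _ _ _ _ _ mu
  (fun z : (T * R) * T => G (r z.1.2) z.1.1 z.2 * v z.2)).
apply: measurable_funM; last by apply: measurableT_comp => //; exact: v2.1.
apply: mGc => //; last exact: measurableT_comp.
by apply: measurableT_comp => //; exact: measurableT_comp.
Qed.

Lemma measurable_time_average v : L2 mu v -> measurable_fun setT (time_average v).
Proof.
move=> v2; apply: (@measurable_fun_Rintegral _ _ _ _ _ leb
  (fun z : T * R => w z.2 * P (r z.2) v z.1)).
by apply: measurable_funM; [exact: measurableT_comp|exact: measurable_smoothing].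
Qed.

(** [time_average] is an iterated integral, as in the scheme. It is identified with the kernel
    operator only where the row is integrable, so bounds and inner products are transferred almost
    everywhere. *)
Let ae_time_average v : L2 mu v -> {ae mu, forall x,
  \int[nu]_p (k (x, p) * v p.2) = time_average v x}.
Proof.
move=> v2.
apply: filterS (@schur_ae_integrable _ _ _ _ _ mu nu k C mk k0 kC _
  (mv2 v2) (kV v2)) => x kx.
rewrite -(@Rintegral12 _ _ _ _ _ leb mu _ kx)/=; apply: eq_Rintegral => tau _.
rewrite /k/=; have [->|wn0] := eqVneq (w tau) 0.
  rewrite mul0r; under eq_Rintegral do rewrite !mul0r.
  by rewrite Rintegral_cst// mul0r.
rewrite /smoothing -RintegralZl//; last exact: smoothing_integrable (r0 wn0) v2.
by apply: eq_Rintegral => y _; rewrite mulrA.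
Qed.

Lemma time_average_L2 v : L2 mu v -> L2 mu (time_average v).
Proof.
move=> v2; have mA := measurable_time_average v2.
have [[mB iB] _] := @schur_L2 _ _ _ _ _ mu nu k C mk k0 C0 kC _ (mv2 v2) (kV v2).
split=> //; apply/integrableP; split.
  by apply/measurable_EFinP; exact: measurable_funX.
have /integrableP[_] := iB; apply: le_lt_trans.
apply: ae_ge0_le_integral => //=.
- by do 2 apply: measurableT_comp => //; exact: measurable_funX.
- by do 2 apply: measurableT_comp => //; exact: measurable_funX.
- by apply: filterS (ae_time_average v2) => x /= -> _.
Qed.

Let prod_integrable u v : L2 mu u -> L2 mu v ->
  Rintegrable (mu \x nu)%E (fun z => k z * (u z.1 * v z.2.2)).
Proof.
by move=> u2 v2; exact: (@schur_integrable _ _ _ _ _ mu nu k C mk k0 C0 kC _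
  (mv2 v2) (kV v2)).
Qed.

Let inner u v p : L2 mu u -> \int[mu]_x (k (x, p) * (u x * v p.2)) =
  w p.1 * (v p.2 * P (r p.1) u p.2).
Proof.
move=> u2; rewrite /k/=; have [->|wn0] := eqVneq (w p.1) 0.
  under eq_Rintegral do rewrite !mul0r.
  by rewrite Rintegral_cst// !mul0r.
rewrite /smoothing mulrA -RintegralZl//.
  by apply: eq_Rintegral => x _; rewrite Gsym; ring.
exact: smoothing_integrable (r0 wn0) u2.
Qed.

Let prod_integrable2 u v : L2 mu u -> L2 mu v ->
  Rintegrable nu (fun p => w p.1 * (v p.2 * P (r p.1) u p.2)).
Proof.
move=> u2 v2.
apply: eq_Rintegrable (@Rintegrable_fubini2 _ _ _ _ _ mu nu _ (prod_integrable u2 v2)).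
by move=> p /=; rewrite -inner.
Qed.

Let slice u v tau : L2 mu u -> L2 mu v ->
  \int[mu]_y (w tau * (v y * P (r tau) u y)) = w tau * q (r tau) v u.
Proof.
move=> u2 v2; have [->|wn0] := eqVneq (w tau) 0.
  by under eq_Rintegral do rewrite mul0r; rewrite Rintegral_cst// !mul0r.
rewrite RintegralZl//; apply: L2_mul => //.
exact: smoothing_L2 (r0 wn0) u2.
Qed.

Lemma time_average_energy_integrable u v : L2 mu u -> L2 mu v ->
  Rintegrable leb (fun tau => w tau * q (r tau) u v).
Proof.
move=> u2 v2.
apply: eq_Rintegrable (@Rintegrable_fubini1 _ _ _ _ _ leb mu _ (prod_integrable2 v2 u2)).
by move=> tau /=; rewrite slice.
Qed.

Lemma ip_time_average u v : L2 mu u -> L2 mu v ->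
  ip mu u (time_average v) = \int[leb]_tau (w tau * q (r tau) u v).
Proof.
move=> u2 v2.
transitivity (ip mu u (fun x => \int[nu]_p (k (x, p) * v p.2))).
  apply: ae_eq_ip.
  - exact: u2.1.
  - exact: measurable_time_average.
  - exact: (@schur_measurable _ _ _ _ _ nu k mk _ (mv2 v2)).
  - by apply: filterS (ae_time_average v2) => x ->.
rewrite (@schur_ip _ _ _ _ _ mu nu k C mk k0 C0 kC _ (mv2 v2) (kV v2) u u2).
rewrite -(@Rintegral21 _ _ _ _ _ mu nu _ (prod_integrable u2 v2))/=.
transitivity (\int[nu]_p (w p.1 * (v p.2 * P (r p.1) u p.2))).
  by apply: eq_Rintegral => p _; rewrite inner.
rewrite -(@Rintegral12 _ _ _ _ _ leb mu _ (prod_integrable2 u2 v2))/=.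
apply: eq_Rintegral => tau _; rewrite slice//.
have [->|wn0] := eqVneq (w tau) 0; first by rewrite !mul0r.
by congr (_ * _); apply: smoothing_sym => //; exact: r0.
Qed.

End time_average.

End markov_semigroup.

(** * The Gaussian heat kernel on R^n *)

Section heat_kernel.
Context (R : realType).

Lemma measurable_invr d (T : measurableType d) (f : T -> R) :
  measurable_fun setT f -> measurable_fun setT (fun x => (f x)^-1).
Proof.
move=> mf.
(* Squaring makes the base of [powR] nonnegative; at f x = 0 the leading factor reproduces the
   default inverse 0. *)
have -> : (fun x => (f x)^-1) = (fun x => f x * (f x ^+ 2) `^ (- 1)).
  apply/funext => x; rewrite powR_inv1 ?sqr_ge0//.
  have [->|f0] := eqVneq (f x) 0; first by rewrite invr0 mul0r.
  by field.
apply: measurable_funM => //.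
apply: (measurableT_comp (measurable_powR _)); exact: measurable_funX.
Qed.

(* A fresh constant, to carry the sigma-finiteness of [lebesgue_tuple]. *)
Definition sflebesgue n : set (n.-tuple R) -> \bar R := lebesgue_tuple R n.
Arguments sflebesgue : clear implicits.

HB.instance Definition _ n := Measure.copy (sflebesgue n) (lebesgue_tuple R n).

Lemma sigma_finite_lebesgue_tuple n : sigma_finite setT (sflebesgue n).
Proof.
pose F (k : nat) : set (n.-tuple R) :=
  [set x | forall i, `[- k%:R, k%:R]%classic (tnth x i)].
exists F.
  apply/esym/seteqP; split=> // x _.
  exists (Num.bound (\sum_(i < n) `|tnth x i|)) => // i.
  rewrite /= in_itv/= -ler_norml ltW//.
  apply: le_lt_trans (archi_boundP _); last exact: sumr_ge0.
  by rewrite (bigD1 i)//= lerDl sumr_ge0.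
move=> k; split.
  rewrite (_ : F k = \bigcap_(i in [set: 'I_n])
      ((@tnth n R ^~ i) @^-1` `[- k%:R, k%:R]%classic)).
    apply: fin_bigcap_measurable => // i _.
    by rewrite -[X in measurable X]setTI; exact: measurable_tnth.
  by apply/seteqP; split=> x /= h i; [move=> _; exact: h|exact: h].
rewrite /sflebesgue (@lebesgue_tuple_box R n (fun=> `[- k%:R, k%:R]%classic))//.
by rewrite lebesgue_measure_itv/=; case: ifPn => _;
  rewrite -?EFinB prodEFin ltry.
Qed.

HB.instance Definition _ n := Measure_isSigmaFinite.Build _ _ _
  (sflebesgue n) (sigma_finite_lebesgue_tuple n).

Lemma ge0_integral_lebesgue_tupleS n (f : n.+1.-tuple R -> \bar R) :
  measurable_fun setT f -> (forall x, 0 <= f x)%E ->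
  (\int[sflebesgue n.+1]_x f x =
   \int[sflebesgue n]_x \int[@lebesgue_measure R]_y
     f (tuple_consp (x, y)))%E.
Proof.
move=> mf f0; rewrite -(@fubini_tonelli1 _ _ _ _ _
  (sflebesgue n) (@lebesgue_measure R) (f \o @tuple_consp R n)).
- transitivity (\int[pushforward (sflebesgue n \x @lebesgue_measure R)%E
    (@tuple_consp R n)]_x f x)%E; first by [].
  by rewrite ge0_integral_pushforward//; exact: measurable_tuple_consp.
- by apply: measurableT_comp => //; exact: measurable_tuple_consp.
- by move=> z; exact: f0.
Qed.

Lemma measurable_heat_kernel n : measurable_fun setT
  (fun p : R * (n.-tuple R * n.-tuple R) => heat_kernel p.1 p.2.1 p.2.2).
Proof.
rewrite /heat_kernel; apply: measurable_funM.
  apply: measurableT_comp => //; apply: measurable_funM.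
    apply: measurableT_comp => //; apply: measurable_sum => i.
    apply: measurable_funX; apply: measurable_funB.
      apply: (measurableT_comp (measurable_tnth i)).
      exact: measurableT_comp.
    apply: (measurableT_comp (measurable_tnth i)).
    exact: measurableT_comp.
  by apply: measurable_invr; apply: measurable_funM.
apply: measurable_invr; apply: (measurableT_comp (measurable_powR _)).
by apply: measurable_funM.
Qed.

Lemma measurable_heat_kernelr n s (x : n.-tuple R) :
  measurable_fun setT (heat_kernel s x).
Proof.
have mp : measurable_fun setT (fun y : n.-tuple R => (s, (x, y))).
  by apply: measurable_fun_pair => //; exact: measurable_fun_pair.
exact: (measurableT_comp (@measurable_heat_kernel n) mp).
Qed.

Lemma sqdistC n (x y : n.-tuple R) : sqdist x y = sqdist y x.
Proof. by apply: eq_bigr => i _; rewrite -sqrrN opprB. Qed.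

Lemma heat_kernel_sym n s (x y : n.-tuple R) :
  heat_kernel s x y = heat_kernel s y x.
Proof. by rewrite /heat_kernel sqdistC. Qed.

Lemma heat_kernel_ge0 n s (x y : n.-tuple R) : 0 <= heat_kernel s x y.
Proof. by rewrite divr_ge0 ?expR_ge0 ?powR_ge0. Qed.

(** Each coordinate contributes a normal density of variance 2 s; the total mass then follows by
    induction on the dimension. *)
Lemma heat_kernelS n s (x x' : n.-tuple R) y y' : 0 < s ->
  heat_kernel s (tuple_consp (x, y)) (tuple_consp (x', y')) =
  heat_kernel s x x' * normal_pdf y (Num.sqrt (2 * s)) y'.
Proof.
move=> s0; have ss0 : 0 < Num.sqrt (2 * s) by rewrite sqrtr_gt0 mulr_gt0.
rewrite normal_pdfE ?gt_eqF// /heat_kernel /sqdist big_ord_recl/=.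
rewrite /normal_peak /normal_fun sqr_sqrtr ?mulr_ge0 ?ltW//.
have -> : \sum_(i < n) (tnth (tuple_consp (x, y)) (lift ord0 i) -
    tnth (tuple_consp (x', y')) (lift ord0 i)) ^+ 2 =
    \sum_(i < n) (tnth x i - tnth x' i) ^+ 2.
  by apply: eq_bigr => i _; rewrite /tuple_consp !tnthS.
have -> : (4 * pi * s) `^ (n.+1%:R / 2) =
    (4 * pi * s) `^ (n%:R / 2) * Num.sqrt (4 * pi * s) :> R.
  rewrite (_ : n.+1%:R / 2 = n%:R / 2 + 2^-1 :> R);
    last by rewrite -[n.+1%:R]natr1; field.
  rewrite powRD.
    by rewrite powR12_sqrt// !mulr_ge0// ?pi_ge0// ltW.
  by rewrite (gt_eqF (_ : 0 < 4 * pi * s :> R)) ?implybT// !mulr_gt0// pi_gt0.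
rewrite /tuple_consp !tnth0/= opprD mulrDl expRD.
have -> : - (y' - y) ^+ 2 / ((2 * s) *+ 2) = - (y - y') ^+ 2 / (4 * s).
  by rewrite -(opprB y) sqrrN -mulr_natr; congr (_ / _); ring.
have -> : 2 * s * pi *+ 2 = 4 * pi * s by rewrite -mulr_natr; ring.
move: (_ `^ _) (Num.sqrt _) (expR _) (expR _) => p q a b.
by rewrite invfM; ring.
Qed.

Lemma integral_heat_kernel n s (x : n.-tuple R) : 0 < s ->
  (\int[sflebesgue n]_y (heat_kernel s x y)%:E = 1)%E.
Proof.
have mh m (z : m.-tuple R) :
    measurable_fun setT (fun y => (heat_kernel s z y)%:E).
  by apply/measurable_EFinP; exact: measurable_heat_kernelr.
move=> s0; elim: n x => [|n IH] x.
  rewrite /sflebesgue/= integral_dirac//=; last exact: mh.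
  rewrite diracE mem_set// mul1e.
  by rewrite /heat_kernel /sqdist big_ord0 oppr0 !mul0r expR0 powRr0 divr1.
rewrite ge0_integral_lebesgue_tupleS//; last first.
  by move=> y; rewrite lee_fin heat_kernel_ge0.
have -> : x = tuple_consp ([tuple of behead x], thead x).
  by rewrite /tuple_consp/= -tuple_eta.
rewrite -[RHS](IH [tuple of behead x]); apply: eq_integral => y _.
under eq_integral do rewrite heat_kernelS// EFinM.
rewrite ge0_integralZl//=.
- by rewrite integral_normal_pdf mule1.
- by apply/measurable_EFinP; exact: measurable_normal_pdf.
- by move=> z _; rewrite lee_fin normal_pdf_ge0.
- by rewrite lee_fin heat_kernel_ge0.
Qed.

(** Completing the square in [z]: the product is again a Gaussian, centred at the mean of x and y
    with weights t and s, at time st/(s + t). The semigroup law thereby reduces to mass one. *)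
Lemma heat_kernel_mul n s t (x y z : n.-tuple R) : 0 < s -> 0 < t ->
  heat_kernel s x z * heat_kernel t z y = heat_kernel (s + t) x y *
  heat_kernel (s * t / (s + t))
    [tuple (t * tnth x i + s * tnth y i) / (s + t) | i < n] z.
Proof.
move=> s0 t0; rewrite /heat_kernel.
set A := sqdist x z; set B := sqdist z y; set A' := sqdist x y.
set B' := sqdist _ z.
have st0 : s + t != 0 by rewrite gt_eqF// addr_gt0.
have sn0 : s != 0 by rewrite gt_eqF.
have tn0 : t != 0 by rewrite gt_eqF.
have E : - A / (4 * s) + - B / (4 * t) =
    - A' / (4 * (s + t)) + - B' / (4 * (s * t / (s + t))).
  rewrite /A /B /A' /B' /sqdist -!sumrN !mulr_suml -!big_split/=.
  by apply: eq_bigr => i _; rewrite tnth_mktuple; field; rewrite sn0 tn0 st0.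
rewrite !mulf_div -!expRD E; congr (_ / _).
have pos u : 0 < u -> 0 <= 4 * pi * u :> R.
  by move=> u0; rewrite ltW// !mulr_gt0// pi_gt0.
rewrite -!powRM; try by apply: pos; rewrite ?divr_gt0 ?mulr_gt0 ?addr_gt0.
by congr (_ `^ _); field.
Qed.

Lemma heat_kernel_semigroup n s t (x y : n.-tuple R) : 0 < s -> 0 < t ->
  (\int[sflebesgue n]_z (heat_kernel s x z * heat_kernel t z y)%:E =
   (heat_kernel (s + t) x y)%:E)%E.
Proof.
move=> s0 t0.
under eq_integral do rewrite heat_kernel_mul// EFinM.
rewrite ge0_integralZl//=.
- by rewrite integral_heat_kernel ?mule1// divr_gt0 ?mulr_gt0 ?addr_gt0.
- by apply/measurable_EFinP; exact: measurable_heat_kernelr.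
- by move=> z _; rewrite lee_fin heat_kernel_ge0.
- by rewrite lee_fin heat_kernel_ge0.
Qed.

End heat_kernel.

Arguments sflebesgue : clear implicits.

(** * Translation invariance, to move every time step to [0, D) *)

Section lebesgue_shift.
Context (R : realType) (a : R).
Local Notation leb := (@lebesgue_measure R).

Let shiftr (x : measurableTypeR R) : measurableTypeR R := x + a.

Let measurable_shiftr : measurable_fun setT shiftr.
Proof. exact: measurable_funD. Qed.

HB.instance Definition _ := isMeasurableFun.Build _ _ _ _ shiftr
  measurable_shiftr.

Let lebesgue_measure_shift (A : set (measurableTypeR R)) : measurable A ->
  pushforward leb shiftr A = leb A.
Proof.
move=> mA; apply/esym/lebesgue_measure_unique => //= _ [[b c]] _ <-.
rewrite /pushforward (_ : _ @^-1` _ = `]b - a, c - a]%classic); last first.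
  by apply/seteqP; split=> x /=; rewrite !in_itv/= /shiftr; lra.
rewrite !lebesgue_measure_itv/= !lte_fin ltrD2r.
by case: ifP => // _; rewrite -!EFinB; congr EFin; ring.
Qed.

Let ge0_integral_shift (f : R -> \bar R) : measurable_fun setT f ->
  (forall x, 0 <= f x)%E -> (\int[leb]_x f (x + a)%R = \int[leb]_x f x)%E.
Proof.
move=> mf f0.
rewrite -(@ge0_integral_pushforward _ _ _ _ _ shiftr measurable_shiftr leb setT f)//.
by apply: eq_measure_integral => A mA _; exact: lebesgue_measure_shift.
Qed.

Lemma Rintegral_shift (f : R -> R) : measurable_fun setT f ->
  \int[leb]_x f (x + a) = \int[leb]_x f x.
Proof.
move=> mf; have mEf : measurable_fun setT (EFin \o f) by exact/measurable_EFinP.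
rewrite /Rintegral integralE [in RHS]integralE; congr (fine (_ - _)%E).
- rewrite -[RHS]ge0_integral_shift//; last exact: measurable_funepos.
  by apply: eq_integral => x _; rewrite !funeposE.
- rewrite -[RHS]ge0_integral_shift//; last exact: measurable_funeneg.
  by apply: eq_integral => x _; rewrite !funenegE.
Qed.

End lebesgue_shift.

(** * Integrals of square roots and their inverses over one time step *)

Section sqrt_integrals.
Context (R : realType) (D : R).
Hypothesis D0 : 0 < D.
Local Notation leb := (@lebesgue_measure R).

Let contB a : continuous (fun x : R => a - x).
Proof. by move=> x; apply: cvgB; [exact: cvg_cst|exact: cvg_id]. Qed.

Let cont_sqrtB a : continuous (fun x : R => Num.sqrt (a - x)).
Proof.
move=> x; apply: (@continuous_comp _ _ _ (fun x : R => a - x) Num.sqrt).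
  exact: contB.
exact: sqrt_continuous.
Qed.

Let sqrtB_derive (a x : R) : x < a ->
  is_derive x 1 (fun x : R => Num.sqrt (a - x)) (- (2 * Num.sqrt (a - x))^-1).
Proof.
move=> xa; have ax : 0 < a - x by rewrite subr_gt0.
have h1 : is_derive x 1 (fun x : R => a - x) (- 1).
  apply: is_derive_eq.
  by rewrite add0r mul1r.
have := @is_derive1_comp R Num.sqrt (fun x : R => a - x) x _ _
  (is_derive1_sqrt ax) h1.
by rewrite mulrN1.
Qed.

Let FTC (f F : R -> R) : {within `[0, D], continuous f} -> continuous F ->
  (forall x, 0 < x -> x < D -> is_derive x 1 F (f x)) ->
  Rintegrable leb (f \_ `[0, D[) /\
  \int[leb]_x (f \_ `[0, D[) x = F D - F 0.
Proof.
move=> cf cF dF.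
have fi : leb.-integrable `[0, D] (EFin \o f).
  by apply: continuous_compact_integrable => //; exact: segment_compact.
have fi' : leb.-integrable `[0, D[ (EFin \o f).
  by apply: integrableS fi => //; exact: subset_itv_co_cc.
split.
  have : leb.-integrable setT ((EFin \o f) \_ `[0, D[).
    by apply: (integrable_mkcond _ _).1.
  by apply: eq_integrable => // x _; rewrite /= restrict_EFin.
rewrite -Rintegral_mkcond Rintegral_itv_bndo_bndc// /Rintegral.
rewrite (@continuous_FTC2 _ f F)//.
- split.
  + by move=> x; rewrite in_itv/= => /andP[x0 xD]; have [] := dF _ x0 xD.
  + exact/cvg_at_right_filter/cF.
  + exact/cvg_at_left_filter/cF.
- move=> x; rewrite in_itv/= => /andP[x0 xD]; rewrite derive1E.
  by apply: derive_val; exact: dF.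
Qed.

Lemma Rintegral_invsqrtB a : D < a ->
  Rintegrable leb ((fun x => (Num.sqrt (a - x))^-1) \_ `[0, D[) /\
  \int[leb]_x ((fun x => (Num.sqrt (a - x))^-1) \_ `[0, D[) x =
   2 * (Num.sqrt a - Num.sqrt (a - D)).
Proof.
move=> Da.
have [|||h1 h2] := @FTC (fun x => (Num.sqrt (a - x))^-1)
  (fun x => - 2 * Num.sqrt (a - x)).
- apply: continuous_in_subspaceT => x; rewrite inE/= in_itv/= => /andP[_ xD].
  apply: cvgV; last exact: cont_sqrtB.
  by rewrite gt_eqF// sqrtr_gt0 subr_gt0 (le_lt_trans xD).
- by move=> x; apply: cvgM; [exact: cvg_cst|exact: cont_sqrtB].
- move=> x _ xD; have xa := lt_trans xD Da.
  have h := sqrtB_derive xa.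
  apply: (is_derive_eq (is_deriveM (is_derive_cst (- 2 : R) x 1) h)).
  rewrite scaler0 addr0 /GRing.scale/=.
  by field; rewrite gt_eqF// sqrtr_gt0 subr_gt0.
by split=> //; rewrite h2 subr0; ring.
Qed.

Lemma Rintegral_sqrtB a : D <= a ->
  Rintegrable leb ((fun x => Num.sqrt (a - x)) \_ `[0, D[) /\
  \int[leb]_x ((fun x => Num.sqrt (a - x)) \_ `[0, D[) x =
   2 / 3 * (a * Num.sqrt a - (a - D) * Num.sqrt (a - D)).
Proof.
move=> Da.
have [|||h1 h2] := @FTC (fun x => Num.sqrt (a - x))
  (fun x => - (2 / 3) * ((a - x) * Num.sqrt (a - x))).
- by apply: continuous_subspaceT; exact: cont_sqrtB.
- move=> x; apply: cvgM; first exact: cvg_cst.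
  by apply: cvgM; [exact: contB|exact: cont_sqrtB].
- move=> x _ xD; have xa := lt_le_trans xD Da.
  have h := sqrtB_derive xa.
  have h1 : is_derive x 1 (fun x : R => a - x) (- 1).
    by apply: is_derive_eq; rewrite add0r mul1r.
  apply: (is_derive_eq (is_deriveM (is_derive_cst (- (2 / 3) : R) x 1)
    (is_deriveM h1 h))).
  rewrite scaler0 addr0 /GRing.scale/=.
  have s0 : 0 < Num.sqrt (a - x) by rewrite sqrtr_gt0 subr_gt0.
  have sE : a - x = Num.sqrt (a - x) ^+ 2 by rewrite sqr_sqrtr// subr_ge0 ltW.
  move: s0 sE; set r := Num.sqrt _ => s0 ->.
  by field; rewrite gt_eqF.
by split=> //; rewrite h2 subr0; ring.
Qed.

(** The integrand is singular at D, where [FTC] asks for continuity. Moving the singularity to D +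
    1/(n+1) gives an increasing approximation whose integrals 2 (sqrt (D + e) - sqrt e) stay below 2
    sqrt D, and monotone convergence concludes. *)
Lemma Rintegral_invsqrt_le :
  Rintegrable leb ((fun x => (Num.sqrt (D - x))^-1) \_ `[0, D[) /\
  \int[leb]_x ((fun x => (Num.sqrt (D - x))^-1) \_ `[0, D[) x <=
   2 * Num.sqrt D.
Proof.
pose g (n : nat) x := ((Num.sqrt (D + n.+1%:R^-1 - x))^-1).
have e0 n : 0 < n.+1%:R^-1 :> R by rewrite invr_gt0.
have De n : D < D + n.+1%:R^-1 by rewrite ltrDl.
have mg n : measurable_fun setT (g n \_ `[0, D[).
  exact: RintegrableP (Rintegral_invsqrtB (De n)).1.
have mEg n : measurable_fun setT (fun x => ((g n \_ `[0, D[) x)%:E).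
  exact: measurable_int (Rintegral_invsqrtB (De n)).1.
have cvg_g x : x < D -> g n x @[n --> \oo] --> (Num.sqrt (D - x))^-1.
  move=> xD; apply: cvgV; first by rewrite gt_eqF// sqrtr_gt0 subr_gt0.
  apply: (@cvg_comp _ _ _ (fun n : nat => D + n.+1%:R^-1 - x) Num.sqrt); last first.
    exact: sqrt_continuous.
  have : (fun n : nat => D + n.+1%:R^-1 - x) @ \oo --> D + 0 - x.
    apply: cvgB; last exact: cvg_cst.
    by apply: cvgD; [exact: cvg_cst|exact: cvg_harmonic].
  by rewrite addr0.
set w := (fun x => (Num.sqrt (D - x))^-1) \_ `[0, D[.
have mw : measurable_fun setT w.
  apply: (measurable_fun_cvg mg) => x _; rewrite /w /patch.
  by case: ifPn => [|_]; [rewrite inE/= in_itv/= => /andP[_]; exact: cvg_g|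
    exact: cvg_cst].
have w0 x : 0 <= w x by rewrite /w /patch; case: ifPn => // _; rewrite invr_ge0.
have ge0 n x : 0 <= (g n \_ `[0, D[) x.
  by rewrite /patch; case: ifPn => // _; rewrite invr_ge0.
have nd_g m n x : (m <= n)%N -> (g m \_ `[0, D[) x <= (g n \_ `[0, D[) x.
  move=> mn; rewrite /patch; case: ifPn => //.
  rewrite inE/= in_itv/= => /andP[_ xD]; rewrite /g.
  have pos k : 0 < D + k.+1%:R^-1 - x by rewrite subr_gt0 (lt_trans xD).
  rewrite lef_pV2 ?posrE ?sqrtr_gt0//.
  by rewrite ler_wsqrtr// lerD2r lerD2l lef_pV2 ?posrE// ler_nat.
have h : (\int[leb]_x (w x)%:E <= (2 * Num.sqrt D)%:E)%E.
  have -> : (\int[leb]_x (w x)%:E =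
      \int[leb]_x limn (fun n => ((g n \_ `[0, D[) x)%:E))%E.
    apply: eq_integral => x _; apply/esym/cvg_lim => //; apply: cvg_EFin.
      by near=> n.
    rewrite /w /patch; case: ifPn => [|_]; last exact: cvg_cst.
    by rewrite inE/= in_itv/= => /andP[_]; exact: cvg_g.
  rewrite monotone_convergence//; last 2 first.
  - by move=> n x _; rewrite lee_fin.
  - by move=> x _ m n mn; rewrite lee_fin; exact: nd_g.
  apply: lime_le.
    apply: ereal_nondecreasing_is_cvgn => m n mn; apply: ge0_le_integral => //.
    + by move=> x _; rewrite lee_fin.
    + exact: mEg.
    + exact: mEg.
    + by move=> x _; rewrite lee_fin; exact: nd_g.
  near=> n; have [gi gE] := Rintegral_invsqrtB (De n).
  rewrite -(EFin_Rintegral gi) gE lee_fin ler_pM2l//.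
  rewrite (addrC D) addrK lerBlDr.
  rewrite -(@ler_pXn2r _ 2) ?nnegrE ?addr_ge0 ?sqrtr_ge0//.
  rewrite sqr_sqrtr ?addr_ge0 ?(ltW D0) ?(ltW (e0 n))// sqrrD.
  rewrite !sqr_sqrtr ?(ltW D0) ?(ltW (e0 n))//.
  have : 0 <= Num.sqrt D * Num.sqrt (n.+1%:R^-1) by rewrite mulr_ge0 ?sqrtr_ge0.
  by move=> p0; rewrite addrAC (addrC D) lerDl mulrn_wge0.
have wi : Rintegrable leb w.
  by apply: ge0_RintegrableP => //; rewrite (le_lt_trans h)// ltry.
by split=> //; rewrite -lee_fin EFin_Rintegral.
Unshelve. all: by end_near. Qed.

End sqrt_integrals.

Lemma sum_sym_split (R : numDomainType) n (x : nat -> nat -> R) :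
  (forall i j, x i j = x j i) ->
  \sum_(i < n) \sum_(j < n) x i j =
  \sum_(i < n) x i i + (\sum_(i < n) \sum_(j < n | (j < i)%N) x i j) *+ 2.
Proof.
move=> xs.
have -> : \sum_(i < n) \sum_(j < n) x i j =
    \sum_(i < n) (x i i + (\sum_(j < n | (j < i)%N) x i j +
                           \sum_(j < n | (i < j)%N) x i j)).
  apply: eq_bigr => i _; rewrite (bigD1 i)//=; congr (_ + _).
  rewrite (bigID (fun j : 'I_n => (j < i)%N))/=; congr (_ + _).
    apply: eq_bigl => j; rewrite andb_idl// => ji.
    by apply/eqP => e; rewrite e ltnn in ji.
  by apply: eq_bigl => j; rewrite -leqNgt [in RHS]ltn_neqAle eq_sym.
rewrite !big_split/= mulr2n; congr (_ + (_ + _)).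
under [RHS]eq_bigr do rewrite big_mkcond.
rewrite [RHS]exchange_big/=; apply: eq_bigr => i _.
by rewrite [LHS]big_mkcond; apply: eq_bigr => j _; rewrite xs.
Qed.

(** * Scalar estimates for the extrapolated diagonal *)

Section diagonal_scalars.
Context (R : rcfType).

(** Here p0, f1, fD, f2 are the values of phi at 0, s, D, s + D, and [psi] is the mean rate of loss
    on [0, D]. The concave loss lies above the line of slope [psi] at s <= D and below it at s + D
    >= D: exactly the directions that the signs of the two terms call for. *)
Lemma diagonal_pointwise (p0 fD f1 f2 s D : R) : 0 < s -> s <= D ->
  f1 <= (1 - s / D) * p0 + s / D * fD ->
  fD <= (1 - D / (s + D)) * p0 + D / (s + D) * f2 ->
  2 * ((Num.sqrt s)^-1 * f1) - (Num.sqrt (s + D))^-1 * f2 <=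
  2 * p0 * (Num.sqrt s)^-1 + (- p0 * (Num.sqrt (s + D))^-1 +
   (- (2 * ((p0 - fD) / D)) * Num.sqrt s +
    (p0 - fD) / D * Num.sqrt (s + D))).
Proof.
move=> s0 sD c1 c2; have D0 := lt_le_trans s0 sD; have t0 := addr_gt0 s0 D0.
set psi := (p0 - fD) / D.
have psiE : fD = p0 - psi * D by rewrite /psi divfK ?gt_eqF//; ring.
have e1 : s * psi <= p0 - f1.
  have E : (1 - s / D) * p0 + s / D * (p0 - psi * D) = p0 - s * psi.
    by field; rewrite gt_eqF.
  by move: c1; rewrite psiE E; clear; lra.
have e2 : p0 - f2 <= (s + D) * psi.
  have E : (1 - D / (s + D)) * p0 + D / (s + D) * f2 =
      p0 - (p0 - f2) / (s + D) * D by field; rewrite gt_eqF.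
  by move: c2; rewrite psiE E lerD2l lerN2 ler_pM2r// ler_pdivrMr// mulrC.
clearbody psi; move: c1 c2 psiE => _ _ _.
have a0 : 0 < Num.sqrt s by rewrite sqrtr_gt0.
have b0 : 0 < Num.sqrt (s + D) by rewrite sqrtr_gt0.
have h1 : Num.sqrt s * psi <= (Num.sqrt s)^-1 * (p0 - f1).
  by rewrite ler_pdivlMl// mulrA -expr2 sqr_sqrtr// ltW.
have h2 : (Num.sqrt (s + D))^-1 * (p0 - f2) <= Num.sqrt (s + D) * psi.
  by rewrite ler_pdivrMl// mulrA -expr2 sqr_sqrtr// ltW.
move: h1 h2; move: (Num.sqrt s) (Num.sqrt (s + D)) => a b; clear; lra.
Qed.

Lemma diagonal_total (p0 psi D I1 : R) : 0 <= p0 -> 0 <= psi -> 0 <= D ->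
  I1 <= 2 * Num.sqrt D ->
  2 * p0 * I1 + (- p0 * (2 * (Num.sqrt (2 * D) - Num.sqrt (2 * D - D))) +
    (- (2 * psi) * (2 / 3 * (D * Num.sqrt D - (D - D) * Num.sqrt (D - D))) +
     psi * (2 / 3 * (2 * D * Num.sqrt (2 * D) - (2 * D - D) * Num.sqrt (2 * D - D)))))
  <= 2 * (3 - Num.sqrt 2) * Num.sqrt D * p0.
Proof.
move=> p00 psi0 D0 HI.
rewrite subrr mul0r subr0 (_ : 2 * D - D = D); last by ring.
rewrite sqrtrM//.
have : 2 * p0 * I1 <= 2 * p0 * (2 * Num.sqrt D) by rewrite ler_wpM2l// mulr_ge0.
have q2 : Num.sqrt 2 ^+ 2 = 2 :> R by rewrite sqr_sqrtr.
have q2le : Num.sqrt 2 <= 3 / 2 :> R.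
  by move: q2 (sqrtr_ge0 (2 : R)); move: (Num.sqrt 2) => a; clear; nra.
have : 0 <= psi * (D * Num.sqrt D) * (3 / 2 - Num.sqrt 2).
  by rewrite mulr_ge0 ?subr_ge0// !mulr_ge0// sqrtr_ge0.
move: (Num.sqrt 2) (Num.sqrt D) => a b; clear; lra.
Qed.

End diagonal_scalars.

(* The diagonal entry that makes a convex sequence [F 1, F 2, ...] convex from
   index 0 on. *)
Definition extrapolate (V : zmodType) (F : nat -> V) l :=
  if l is 0%N then F 1%N *+ 2 - F 2%N else F l.

Lemma extrapolate_sym (V : zmodType) (F : nat -> nat -> nat -> V) l i j :
  (forall l, (0 < l)%N -> F l i j = F l j i) ->
  extrapolate (fun l => F l i j) l = extrapolate (fun l => F l j i) l.
Proof. by case: l => [|l] Fs; rewrite /= !Fs. Qed.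

(** * The cross terms of the scheme as a Toeplitz form in the lag *)

Section cross_terms.
Context d (T : measurableType d) (R : realType).
Variables (mu : {sigma_finite_measure set T -> \bar R}) (G : R -> T -> T -> R).
Hypothesis mG : measurable_fun setT (fun p : R * (T * T) => G p.1 p.2.1 p.2.2).
Hypothesis G0 : forall s x y, 0 <= G s x y.
Hypothesis Gsym : forall s x y, G s x y = G s y x.
Hypothesis G1 : forall s x, 0 < s -> (\int[mu]_y (G s x y)%:E = 1)%E.
Hypothesis GG : forall s t x y, 0 < s -> 0 < t ->
  (\int[mu]_z (G s x z * G t z y)%:E = (G (s + t) x y)%:E)%E.
Variable D : R.
Hypothesis D0 : 0 < D.
Local Notation leb := (@lebesgue_measure R).
Local Notation q := (energy mu G).
Local Notation phi := (energy0 mu G).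

(** [l] is the lag n - m between two steps. Extension by 0 lets all integrals run over R; outside
    [0, D) the time [step_time l] may be negative, but there the weight vanishes. *)
Definition step_weight l : R -> R :=
  (fun tau => (Num.sqrt (l%:R * D - tau))^-1) \_ `[0, D[.
Definition step_time l tau : R := l%:R * D - tau.
Local Notation w := step_weight.
Local Notation r := step_time.

Lemma step_weightE l tau : 0 <= tau < D -> w l tau = (Num.sqrt (r l tau))^-1.
Proof. by move=> h; rewrite /w /patch mem_set//= in_itv. Qed.

Lemma step_weight0 l tau : ~~ (0 <= tau < D) -> w l tau = 0.
Proof. by move=> h; rewrite /w /patch memNset//= in_itv/=; exact/negP. Qed.

Lemma step_time_gt0 l tau : (0 < l)%N -> 0 <= tau < D -> 0 < r l tau.
Proof.
move=> l0 /andP[_ tD]; rewrite subr_gt0 (lt_le_trans tD)//.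
by rewrite ler_peMl ?(ltW D0)// ler1n.
Qed.

Lemma step_weight_ge0 l tau : 0 <= w l tau.
Proof. by rewrite /w /patch; case: ifP => // _; rewrite invr_ge0. Qed.

Lemma step_weight_time l tau : (0 < l)%N -> w l tau != 0 -> 0 < r l tau.
Proof.
move=> l0; case: (boolP (0 <= tau < D)) => h; first by rewrite step_time_gt0.
by rewrite step_weight0// eqxx.
Qed.

Lemma step_weight_le l m tau : (0 < l <= m)%N -> w m tau <= w l tau.
Proof.
case: (boolP (0 <= tau < D)) => h; last by rewrite !step_weight0.
move=> /andP[l0 lm]; have m0 := leq_trans l0 lm.
rewrite !step_weightE// lef_pV2 ?posrE ?sqrtr_gt0 ?step_time_gt0//.
by rewrite ler_wsqrtr// lerD2r ler_pM2r// ler_nat.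
Qed.

Lemma step_weight_integrable l : (0 < l)%N -> Rintegrable leb (w l).
Proof.
case: l => [//|[|l]] _; rewrite /step_weight.
  by rewrite mul1r; have [] := Rintegral_invsqrt_le D0.
have h : D < l.+2%:R * D by rewrite ltr_pMl// ltr1n.
by have [] := Rintegral_invsqrtB D0 h.
Qed.

Lemma step_weight_mass l : (0 < l)%N -> \int[leb]_tau w l tau <= 2 * Num.sqrt D.
Proof.
move=> l0; have [_] := Rintegral_invsqrt_le D0; apply: le_trans.
have -> : (fun x => (Num.sqrt (D - x))^-1) \_ `[0, D[ = w 1.
  by rewrite /step_weight mul1r.
apply: le_Rintegral => //; [exact: step_weight_integrable..|].
by move=> tau _; exact: step_weight_le.
Qed.

Lemma measurable_step_time l : measurable_fun setT (r l).
Proof. exact: measurable_funB. Qed.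

Definition history l := time_average mu G (w l) (r l).

Let C0 : 0 < 2 * Num.sqrt D. Proof. by rewrite mulr_gt0// sqrtr_gt0. Qed.

Lemma history_L2 l v : (0 < l)%N -> L2 mu v -> L2 mu (history l v).
Proof.
move=> l0 v2; apply: (@time_average_L2 _ _ _ _ _ mG G0 Gsym G1 GG
  (w l) (r l) (2 * Num.sqrt D)) => //.
- exact: RintegrableP (step_weight_integrable l0).
- exact: measurable_step_time.
- exact: step_weight_ge0.
- by move=> tau; exact: step_weight_time.
- exact: step_weight_integrable.
- exact: step_weight_mass.
Qed.

Lemma history_energy l u v : (0 < l)%N -> L2 mu u -> L2 mu v ->
  Rintegrable leb (fun tau => w l tau * q (r l tau) u v) /\
  ip mu u (history l v) = \int[leb]_tau (w l tau * q (r l tau) u v).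
Proof.
move=> l0 u2 v2; have mw := RintegrableP (step_weight_integrable l0).
split.
- apply: (@time_average_energy_integrable _ _ _ _ _ mG G0 Gsym G1 GG
    (w l) (r l) (2 * Num.sqrt D)) => //.
  + exact: measurable_step_time.
  + exact: step_weight_ge0.
  + by move=> tau; exact: step_weight_time.
  + exact: step_weight_integrable.
  + exact: step_weight_mass.
- apply: (@ip_time_average _ _ _ _ _ mG G0 Gsym G1 GG
    (w l) (r l) (2 * Num.sqrt D)) => //.
  + exact: measurable_step_time.
  + exact: step_weight_ge0.
  + by move=> tau; exact: step_weight_time.
  + exact: step_weight_integrable.
  + exact: step_weight_mass.
Qed.

Let phi_ge0 u s : L2 mu u -> 0 <= phi u s.
Proof. exact: energy0_ge0. Qed.
Let phi_le u s : L2 mu u -> phi u s <= ip mu u u.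
Proof. exact: energy0_le. Qed.
Let phi_mid u s t : L2 mu u -> 0 <= s -> 0 <= t ->
  phi u ((s + t) / 2) <= (phi u s + phi u t) / 2.
Proof. exact: energy0_mid. Qed.

(** Holds for each [tau] before integration. The factor 2 comes from folding the symmetric Toeplitz
    sum onto its lower triangle. *)
Lemma toeplitz_energy n (sigma : nat -> T -> R) tau :
  (forall i, (i < n)%N -> L2 mu (sigma i)) -> 0 <= tau < D ->
  0 <= \sum_(i < n) (2 * (w 1 tau * q (r 1 tau) (sigma i) (sigma i)) -
                    w 2 tau * q (r 2 tau) (sigma i) (sigma i)) +
       2 * \sum_(i < n) \sum_(j < n | (j < i)%N)
             w (i - j) tau * q (r (i - j) tau) (sigma i) (sigma j).
Proof.
move=> s2 ht.
(* [q] is only symmetric on square integrable functions. *)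
pose sig i := if (i < n)%N then sigma i else (fun=> 0).
have sig2 i : L2 mu (sig i).
  by rewrite /sig; case: ifP => [/s2//|_]; exact: L2_0.
pose F l i j := w l tau * q (r l tau) (sig i) (sig j).
pose a l i j := extrapolate (fun l => F l i j) l.
have Fsym l i j : (0 < l)%N -> F l i j = F l j i.
  move=> l0; rewrite /F /energy.
  by rewrite (@smoothing_sym _ _ _ _ _ mG G0 Gsym G1 GG _ _ _ (step_time_gt0 l0 ht)).
have asym i j : a (ndist i j) i j = a (ndist j i) j i.
  rewrite (_ : ndist j i = ndist i j); last by rewrite /ndist; lia.
  by apply: (extrapolate_sym (F := F)) => l; exact: Fsym.
have : 0 <= \sum_(i < n) \sum_(j < n) a (ndist i j) i j.
  (* By bilinearity the window sum of [F l] over [P] is the weighted energy of [W P], so the three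
     window hypotheses of [toeplitz_ge0] become monotonicity and convexity of one scalar sequence
     [f P]. *)
  pose W (P : pred nat) y := \sum_(i < n | P i) sig i y.
  have W2 P : L2 mu (W P) by apply: L2_sum => i _; exact: sig2.
  pose f P l := w l tau * phi (W P) (r l tau).
  have Fw (P : pred nat) l : (0 < l)%N ->
      \sum_(i < n | P i) \sum_(j < n | P j) F l i j = f P l.
    move=> l0; have rl0 := step_time_gt0 l0 ht.
    rewrite /f /energy0 rl0 (@energy_sum _ _ _ _ _ mG G0 Gsym G1 GG _ n sig P)//.
    rewrite mulr_sumr; apply: eq_bigr => i _.
    by rewrite mulr_sumr.
  have phimono P l : (0 < l)%N -> phi (W P) (r l.+1 tau) <= phi (W P) (r l tau).
    move=> l0; apply: (@midconvex_nonincreasing _ _ (ip mu (W P) (W P))).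
    - by move=> s _; exact: phi_ge0.
    - by move=> s _; exact: phi_le.
    - by move=> s t s0 t0; exact: phi_mid.
    - exact/ltW/step_time_gt0.
    - by rewrite lerD2r ler_pM2r// ler_nat.
  have f0 P l : 0 <= f P l by rewrite mulr_ge0 ?step_weight_ge0// phi_ge0.
  have f1 P l : (0 < l)%N -> f P l.+1 <= f P l.
    move=> l0; apply: ler_pM.
    - exact: step_weight_ge0.
    - exact: phi_ge0.
    - by apply: step_weight_le; rewrite l0/=.
    - exact: phimono.
  have f2 P l : (0 < l)%N -> f P l.+1 *+ 2 <= f P l + f P l.+2.
    move=> l0; have rl0 := step_time_gt0 l0 ht.
    have r1 : r l.+1 tau = r l tau + D by rewrite /r -natr1; ring.
    have r2 : r l.+2 tau = r l tau + D *+ 2.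
      by rewrite /r -[l.+2%:R]natr1 -[l.+1%:R]natr1; ring.
    apply: mul_convex.
    - exact: step_weight_ge0.
    - by apply: step_weight_le; rewrite /=.
    - by apply: step_weight_le; rewrite l0/=.
    - rewrite !step_weightE// r1 r2; apply: invsqrt_convex => //; exact: ltW.
    - exact: phi_ge0.
    - exact: phimono.
    - exact: phimono.
    - have := phi_mid (W2 P) (ltW rl0) (ltW (step_time_gt0 (ltn0Sn l.+1) ht)).
      rewrite (_ : (_ + _) / 2 = r l.+1 tau); last by rewrite r1 r2; field.
      by move: (phi _ _) (phi _ _) (phi _ _) => x y z; rewrite -mulr_natr; lra.
  (* Extrapolation makes the second difference of [g P] at 0 vanish and its first difference there
     equal to the next one, f 1 - f 2. *)
  clearbody f; pose g P l := if l is 0%N then f P 1%N *+ 2 - f P 2%N else f P l.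
  have aw (P : pred nat) l : \sum_(i < n | P i) \sum_(j < n | P j) a l i j = g P l.
    case: l => [|l]; last exact: Fw.
    rewrite /g -!Fw// -sumrMnl -sumrB; apply: eq_bigr => i _.
    by rewrite -sumrMnl -sumrB.
  clearbody a; apply: toeplitz_ge0 => l P.
  - rewrite aw; case: l => [|l]; last exact: f0.
    by rewrite /g; have := f0 P 1%N; have := f1 P 1%N isT; lra.
  - under eq_bigr do rewrite sumrB.
    rewrite sumrB !aw; case: l => [|l]; rewrite /g subr_ge0; last exact: f1.
    by have := f1 P 1%N isT; lra.
  - under eq_bigr do rewrite big_split sumrB sumrMnl/=.
    rewrite big_split sumrB sumrMnl/= !aw; case: l => [|l]; rewrite /g ?Fw//.
      by lra.
    by have := f2 P l.+1 isT; lra.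
rewrite (@sum_sym_split _ n (fun i j => a (ndist i j) i j))//.
have sigE i : (i < n)%N -> sig i = sigma i by rewrite /sig => ->.
rewrite -[X in _ + X]mulr_natl; congr (0 <= _ + 2 * _).
- apply: eq_bigr => i _; rewrite /ndist subnn/= /F sigE//.
  by rewrite mulr_natl.
- apply: eq_bigr => i _; apply: eq_bigr => j ji.
  rewrite (_ : ndist i j = (i - j)%N); last by rewrite /ndist; lia.
  by move: (ji); rewrite -subn_gt0; case E : (i - j)%N => [//|l] _;
    rewrite /a /F !sigE.
Qed.

Lemma diagonal_integrable u : L2 mu u -> Rintegrable leb (fun tau =>
  2 * (w 1 tau * q (r 1 tau) u u) - w 2 tau * q (r 2 tau) u u).
Proof.
move=> u2; have [i1 _] := history_energy (ltn0Sn 0) u2 u2.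
have [i2 _] := history_energy (ltn0Sn 1) u2 u2.
apply: (eq_Rintegrable _ (RintegrableD (RintegrableZ 2 i1) (RintegrableZ (-1) i2))).
by move=> x; rewrite mulN1r.
Qed.

(* The numerical coefficient 6 - 2 sqrt 2 = 2 (3 - sqrt 2) comes from
   [phi u 0 = |u|^2]; the loss [phi u 0 - phi u s] is compared with its
   value at [s = D] by concavity, and contributes with a favourable sign. *)
Lemma diagonal_energy u : L2 mu u ->
  \int[leb]_tau (2 * (w 1 tau * q (r 1 tau) u u) - w 2 tau * q (r 2 tau) u u)
  <= 2 * (3 - Num.sqrt 2) * Num.sqrt D * ip mu u u.
Proof.
move=> u2.
have [j1 J1] := Rintegral_sqrtB D0 (lexx D).
have DD : D < 2 * D by rewrite ltr_pMl// ltr1n.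
have [j2 J2] := Rintegral_sqrtB D0 (ltW DD).
have k1 := step_weight_integrable (ltn0Sn 0).
have K1 := step_weight_mass (ltn0Sn 0).
have [k2 K2] := Rintegral_invsqrtB D0 DD.
rewrite -/(w 2) in k2 K2.
set V1 := (fun x => Num.sqrt (D - x)) \_ _ in j1 J1.
set V2 := (fun x => Num.sqrt (2 * D - x)) \_ _ in j2 J2.
pose psi := (ip mu u u - phi u D) / D.
have psi0 : 0 <= psi by rewrite divr_ge0 ?(ltW D0)// subr_ge0; exact: phi_le.
have l1 := RintegrableZ (2 * ip mu u u) k1.
have l2 := RintegrableZ (- ip mu u u) k2.
have l3 := RintegrableZ (- (2 * psi)) j1; have l4 := RintegrableZ psi j2.
have l34 := RintegrableD l3 l4; have l234 := RintegrableD l2 l34.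
apply: (le_trans (le_Rintegral measurableT (diagonal_integrable u2)
  (RintegrableD l1 l234) _)); last first.
  rewrite (RintegralD measurableT l1 l234) (RintegralD measurableT l2 l34).
  rewrite (RintegralD measurableT l3 l4).
  rewrite (RintegralZl _ measurableT k1) (RintegralZl _ measurableT k2).
  rewrite (RintegralZl _ measurableT j1) (RintegralZl _ measurableT j2) J1 J2 K2.
  exact: diagonal_total (ip_ge0 _ _) psi0 (ltW D0) K1.
move=> tau _; case: (boolP (0 <= tau < D)) => h; last first.
  rewrite !step_weight0// /V1 /V2 /patch !memNset/= ?in_itv/=; [|exact/negP..].
  by rewrite !mul0r !mulr0 !addr0 subr0.
have r1 := step_time_gt0 (ltn0Sn 0) h; have r2 := step_time_gt0 (ltn0Sn 1) h.
have r1E : r 1 tau = D - tau by rewrite /r mul1r.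
have r2E : r 2 tau = D - tau + D by rewrite /r; ring.
have -> : V1 tau = Num.sqrt (D - tau) by rewrite /V1 /patch mem_set/= ?in_itv.
have -> : V2 tau = Num.sqrt (D - tau + D).
  by rewrite /V2 /patch mem_set/= ?in_itv//; congr Num.sqrt; ring.
rewrite (step_weightE 1 h) (step_weightE 2 h).
have -> : q (r 1 tau) u u = phi u (r 1 tau) by rewrite /energy0 r1.
have -> : q (r 2 tau) u u = phi u (r 2 tau) by rewrite /energy0 r2.
have chord := midconvex_chord (fun s _ => phi_ge0 s u2)
  (fun s _ => phi_le s u2) (fun s t => phi_mid u2).
have phi0E : phi u 0 = ip mu u u by rewrite /energy0 ltxx.
rewrite r1E in r1 *; rewrite r2E in r2 *.
have sD : D - tau <= D by rewrite lerBlDr lerDl; case/andP: h.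
apply: (diagonal_pointwise r1 sD); rewrite -phi0E.
(* Two chords of phi: D - tau as a point of [0, D], then D as a point of [0, 2 D - tau]. *)
- have := chord D ((D - tau) / D) (ltW D0); rewrite divfK ?gt_eqF//; apply.
  by rewrite divr_ge0 ?ler_pdivrMr ?mul1r ?sD// ltW.
- have := chord (D - tau + D) (D / (D - tau + D)) (ltW r2).
  rewrite divfK ?gt_eqF//; apply.
  by rewrite divr_ge0 ?(ltW D0) ?(ltW r2)//= ler_pdivrMr// mul1r lerDr ltW.
Qed.

Lemma cross_terms_ge n (sigma : nat -> T -> R) :
  (forall i, (i < n)%N -> L2 mu (sigma i)) ->
  - ((3 - Num.sqrt 2) * Num.sqrt D * \sum_(i < n) ip mu (sigma i) (sigma i)) <=
  \sum_(i < n) \sum_(j < n | (j < i)%N)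
    ip mu (sigma i) (history (i - j) (sigma j)).
Proof.
move=> s2.
pose X i j tau := if (j < i)%N
  then w (i - j) tau * q (r (i - j) tau) (sigma i) (sigma j) else 0.
have Xi i j : (i < n)%N -> (j < n)%N -> Rintegrable leb (X i j).
  move=> ni nj; rewrite /X; case ji : (j < i)%N; last exact: integrable0.
  by rewrite -subn_gt0 in ji; have [] := history_energy ji (s2 i ni) (s2 j nj).
pose Y i tau := 2 * (w 1 tau * q (r 1 tau) (sigma i) (sigma i)) -
                    w 2 tau * q (r 2 tau) (sigma i) (sigma i).
have Yi i : (i < n)%N -> Rintegrable leb (Y i).
  by move=> ni; exact: diagonal_integrable (s2 i ni).
have XX i : (i < n)%N -> Rintegrable leb (fun tau => \sum_(j < n) X i j tau).
  move=> ni; apply: (@Rintegrable_sum _ _ _ leb n (X i) predT) => j nj.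
  exact: Xi.
have -> : \sum_(i < n) \sum_(j < n | (j < i)%N)
    ip mu (sigma i) (history (i - j) (sigma j)) =
    \int[leb]_tau \sum_(i < n) \sum_(j < n) X i j tau.
  rewrite (@Rintegral_sum _ _ _ leb n (fun i tau => \sum_(j < n) X i j tau) predT)//.
  apply: eq_bigr => i _; rewrite (@Rintegral_sum _ _ _ leb n (X i) predT); last first.
    by move=> j nj; exact: Xi.
  rewrite big_mkcond; apply: eq_bigr => j _; rewrite /X; case: ifPn => ji.
    rewrite -subn_gt0 in ji.
    by have [_ ->] := history_energy ji (s2 i (ltn_ord i)) (s2 j (ltn_ord j)).
  by rewrite Rintegral_cst// mul0r.
apply: (@le_trans _ _ (\int[leb]_tau ((- 2^-1) * \sum_(i < n) Y i tau))).
  rewrite RintegralZl//; last exact: (@Rintegrable_sum _ _ _ leb n Y predT).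
  rewrite (@Rintegral_sum _ _ _ leb n Y predT)// mulNr lerN2 mulr_sumr.
  rewrite mulr_sumr; apply: ler_sum => i _.
  have := diagonal_energy (s2 i (ltn_ord i)); rewrite -/(Y i).
  move: (Rintegral _ _ _) (ip _ _ _) (Num.sqrt 2) (Num.sqrt D) => x y z t.
  by lra.
apply: le_Rintegral => //.
- exact/RintegrableZ/(@Rintegrable_sum _ _ _ leb n Y predT).
- exact: (@Rintegrable_sum _ _ _ leb n (fun i tau => \sum_(j < n) X i j tau)
    predT).
move=> tau _; case: (boolP (0 <= tau < D)) => h.
  have := toeplitz_energy s2 h.
  have -> : \sum_(i < n) \sum_(j < n | (j < i)%N)
      w (i - j) tau * q (r (i - j) tau) (sigma i) (sigma j) =
      \sum_(i < n) \sum_(j < n) X i j tau.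
    by apply: eq_bigr => i _; rewrite big_mkcond.
  rewrite -/(Y _ _).
  by move: (\sum_(i < n) Y i tau) (\sum_(i < n) \sum_(j < n) _) => x y; lra.
rewrite !big1 ?mulr0// => i _.
  by apply: big1 => j _; rewrite /X; case: ifP; rewrite ?step_weight0// mul0r.
by rewrite /Y !step_weight0// !mul0r mulr0 subr0.
Qed.

End cross_terms.

(** Scaling [u] by e and [v] by 2 keeps the inequality free of division by e. *)
Lemma ip_young d (T : measurableType d) (R : realType)
    (mu : {measure set T -> \bar R}) (e : R) (u v : T -> R) :
  L2 mu u -> L2 mu v ->
  e * ip mu u v *+ 4 <= e ^+ 2 * ip mu u u + ip mu v v *+ 4.
Proof.
move=> u2 v2; have eu := L2Z e u2; have tv := L2Z 2 v2.
have := ip_le_half eu tv.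
rewrite (ipZr _ eu v2) (ipZr _ eu u2) (ipZr _ tv v2) !(ipC _ (fun x => _ * _)).
rewrite !ipZr// (ipC _ v u).
move: (ip mu u v) (ip mu u u) (ip mu v v) => x y z.
by rewrite expr2; clear; lra.
Qed.

(* Young's inequality with the weight that absorbs half of the left side. *)
Lemma sqrt_absorb (R : rcfType) (e S Q X : R) : 0 < e -> 0 <= S -> 0 <= Q ->
  e * S <= 2 * X -> e * X *+ 4 <= e ^+ 2 * S + Q *+ 4 ->
  Num.sqrt S <= 2 / e * Num.sqrt Q.
Proof.
move=> e0 S0 Q0 eS eX; have := ler_wpM2l (ltW e0) eS => eeS.
have tQ : 0 <= 2 / e * Num.sqrt Q.
  by rewrite mulr_ge0 ?sqrtr_ge0// divr_ge0// ltW.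
rewrite -(@ler_pXn2r _ 2) ?nnegrE ?sqrtr_ge0//.
rewrite exprMn !sqr_sqrtr// expr_div_n mulrAC ler_pdivlMr ?exprn_gt0//.
by move: eX eeS; rewrite expr2; clear; lra.
Qed.

(** * The scheme on R^n: square integrability and the energy estimate *)

Section forward_euler_energy.
Context (R : realType) (n : nat).
Local Notation mu := (sflebesgue R n).
Local Notation G := (@heat_kernel R n).
Local Notation leb := (@lebesgue_measure R).

Let mG := @measurable_heat_kernel R n.
Let G0 := @heat_kernel_ge0 R n.
Let Gsym := @heat_kernel_sym R n.
Let G1 := @integral_heat_kernel R n.
Let GG := @heat_kernel_semigroup R n.

Lemma smoothing_lebesgue_tuple s (v : n.-tuple R -> R) x :
  \int[lebesgue_tuple R n]_y (heat_kernel s x y * v y) = smoothing mu G s v x.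
Proof. by []. Qed.

(** Origin of the Toeplitz structure: after a shift of tau by m D the kernel depends on k and m only
    through the lag k - m. *)
Lemma step_integral_history (D : R) (k m : nat) (v : n.-tuple R -> R) x :
  0 < D -> (m < k)%N -> L2 mu v ->
  \int[leb]_(tau in `[m%:R * D, m.+1%:R * D[)
    ((Num.sqrt (k%:R * D - tau))^-1 *
     \int[lebesgue_tuple R n]_y (heat_kernel (k%:R * D - tau) x y * v y)) =
  history mu G D (k - m) v x.
Proof.
move=> D0 mk v2; have km0 : (0 < k - m)%N by rewrite subn_gt0.
pose h tau := step_weight D (k - m) tau *
  smoothing mu G (step_time D (k - m) tau) v x.
have mh : measurable_fun setT h.
  apply: measurable_funM; first exact: RintegrableP (step_weight_integrable D0 km0).
  have := @measurable_smoothing _ _ _ mu G mG _ (measurable_step_time D (k - m)) _ v2.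
  by move=> /(measurable_fun_pair2 x).
rewrite -[RHS](Rintegral_shift (- (m%:R * D)) mh) Rintegral_mkcond.
apply: eq_Rintegral => tau _; rewrite /h /patch.
have kmE : step_time D (k - m) (tau - m%:R * D) = k%:R * D - tau.
  by rewrite /step_time natrB ?(ltnW mk)//; ring.
have [/andP[h1 h2]|hn] := boolP (m%:R * D <= tau < m.+1%:R * D).
  have ht : 0 <= tau - m%:R * D < D.
    by move: h2; rewrite -natr1 => h2; apply/andP; split; lra.
  rewrite mem_set; last by rewrite /= in_itv/= h1.
  by rewrite smoothing_lebesgue_tuple (step_weightE _ ht) kmE.
rewrite memNset/= ?in_itv/=; last exact/negP.
rewrite step_weight0 ?mul0r//; apply: contra hn => /andP[h1 h2].
by rewrite -natr1; apply/andP; split; lra.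
Qed.

Section scheme.
Variables (kappa dt : R) (N : nat) (f : n.-tuple R -> R -> R).
Variable sigma : nat -> n.-tuple R -> R.
Hypotheses (kappa0 : 0 < kappa) (dt0 : 0 < dt).
Let F (k : nat) x := f x (k%:R * dt).
Hypothesis F2 : forall k, (k <= N)%N -> L2 mu (F k).
Hypothesis hsigma : forward_euler_robin kappa dt N f sigma.

Let a := kappa / Num.sqrt pi.

Let historyL2 l v : (0 < l)%N -> L2 mu v -> L2 mu (history mu G dt l v).
Proof. by move=> l0 v2; exact: (history_L2 mG G0 Gsym G1 GG dt0 l0 v2). Qed.

Let sigmaE k : (k <= N)%N -> (forall m, (m < k)%N -> L2 mu (sigma m)) ->
  sigma k = fun x => 2 * F k x +
    (- a) * \sum_(m < k) history mu G dt (k - m) (sigma m) x.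
Proof.
move=> kN s2; apply/funext => x.
have H : \sum_(m < k) history mu G dt (k - m) (sigma m) x =
    \sum_(m < k) \int[leb]_(tau in `[m%:R * dt, m.+1%:R * dt[)
      ((Num.sqrt (k%:R * dt - tau))^-1 * \int[lebesgue_tuple R n]_y
        (heat_kernel (k%:R * dt - tau) x y * sigma m y)).
  apply: eq_bigr => m _; apply/esym.
  exact: step_integral_history dt0 (ltn_ord m) (s2 _ (ltn_ord m)).
have <- := etrans (congr1 (fun z => sigma k x + a * z) H) (hsigma kN x).
by rewrite mulNr addrK.
Qed.

(** The scheme being explicit, sigma_k is a combination of f_k and of histories of earlier steps;
    strong induction carries square integrability over from the data. *)
Lemma forward_euler_L2 k : (k <= N)%N -> L2 mu (sigma k).
Proof.
elim/ltn_ind: k => k IH kN.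
have s2 m : (m < k)%N -> L2 mu (sigma m).
  by move=> mk; apply: IH => //; exact: leq_trans (ltnW mk) kN.
rewrite (sigmaE kN s2); apply: L2D; first exact/L2Z/F2.
apply: L2Z; apply: (@L2_sum _ _ _ mu k
  (fun m => history mu G dt (k - m) (sigma m)) predT) => m mk.
by apply: historyL2; [rewrite subn_gt0|exact: s2].
Qed.

Lemma forward_euler_energy :
  (1 - (3 - Num.sqrt 2) * (a * Num.sqrt dt)) *
    \sum_(k < N.+1) ip mu (sigma k) (sigma k) <=
  2 * \sum_(k < N.+1) ip mu (sigma k) (F k).
Proof.
have s2 k : (k < N.+1)%N -> L2 mu (sigma k) by exact: forward_euler_L2.
have hist2 k m : (k < N.+1)%N -> (m < k)%N ->
    L2 mu (history mu G dt (k - m) (sigma m)).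
  move=> kN mk; apply: historyL2; first by rewrite subn_gt0.
  by apply: s2; exact: ltn_trans mk kN.
have step (k : 'I_N.+1) : ip mu (sigma k) (sigma k) =
    2 * ip mu (sigma k) (F k) - a * \sum_(m < N.+1 | (m < k)%N)
      ip mu (sigma k) (history mu G dt (k - m) (sigma m)).
  have kN : (k <= N)%N by rewrite -ltnS.
  have skm m : (m < k)%N -> L2 mu (sigma m).
    by move=> mk; apply: s2; exact: ltn_trans mk (ltn_ord k).
  have sk := s2 k (ltn_ord k).
  have h2 : L2 mu (fun x => \sum_(m < k) history mu G dt (k - m) (sigma m) x).
    apply: (@L2_sum _ _ _ mu k
      (fun m => history mu G dt (k - m) (sigma m)) predT) => m mk.
    exact: hist2.
  rewrite {2}(sigmaE kN skm) (ipDr sk); [|exact/L2Z/F2|exact: L2Z].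
  rewrite (ipZr _ sk (F2 kN)) (ipZr _ sk h2) mulNr.
  rewrite (@ip_sumr _ _ _ mu k _
    (fun m => history mu G dt (k - m) (sigma m)) predT sk); last first.
    by move=> m mk; exact: hist2.
  by rewrite (big_ord_widen N.+1 (fun m =>
    ip mu (sigma k) (history mu G dt (k - m) (sigma m))))// ltnW.
have a0 : 0 <= a by rewrite divr_ge0 ?sqrtr_ge0// ltW.
have := cross_terms_ge mG G0 Gsym G1 GG dt0 s2.
move=> /(ler_wpM2l a0).
have -> : \sum_(k < N.+1) ip mu (sigma k) (sigma k) =
    2 * \sum_(k < N.+1) ip mu (sigma k) (F k) -
    a * \sum_(k < N.+1) \sum_(m < N.+1 | (m < k)%N)
      ip mu (sigma k) (history mu G dt (k - m) (sigma m)).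
  by rewrite !mulr_sumr -sumrB; apply: eq_bigr => k _; rewrite -step.
move: (\sum_(k < N.+1) ip _ _ (F _)) (\sum_(k < N.+1) \sum_(_ < _ | _) _) => X Y.
by move: (Num.sqrt 2) (Num.sqrt dt) (a) => u v b; lra.
Qed.

End scheme.

Lemma l2L2normE N (g : nat -> n.-tuple R -> R) :
  (forall k, (k <= N)%N -> L2 mu (g k)) ->
  l2L2norm N g = (Num.sqrt (\sum_(k < N.+1) ip mu (g k) (g k)))%:E.
Proof.
move=> g2; rewrite /l2L2norm.
have nE (k : 'I_N.+1) :
    ('N[lebesgue_tuple R n]_2%:E [EFin \o g k] ^+ 2 = (ip mu (g k) (g k))%:E)%E.
  have [mg gi] : L2 mu (g k) by apply: g2; rewrite -ltnS.
  have e : (\int[lebesgue_tuple R n]_x (`|(EFin \o g k) x| `^ 2) =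
      (ip mu (g k) (g k))%:E)%E.
    transitivity (\int[mu]_x (g k x ^+ 2)%:E)%E.
      apply: eq_integral => x _.
      by rewrite /= powR_mulrn// -normrX ger0_norm ?sqr_ge0.
    by rewrite -EFin_Rintegral.
  rewrite unlock e poweR_EFin -EFin_expe -powR_mulrn ?powR_ge0//.
  by rewrite -powRrM mulVf// powRr1// ip_ge0.
under eq_bigr do rewrite nE.
by rewrite sumEFin poweR_EFin powR12_sqrt// sumr_ge0// => k _; exact: ip_ge0.
Qed.

End forward_euler_energy.

Theorem mainTheorem9 (R : realType) (d : nat) (hd : (2 <= d)%N)
    (c kappa dt h : R) (hc : c = 3 - Num.sqrt 2) (hkappa : 0 < kappa)
    (hdt0 : 0 < dt) (hdt : dt < pi / (c ^+ 2 * kappa ^+ 2))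
    (hh : h = kappa ^+ 2 * dt / pi)
    (N : nat) (hN : (1 <= N)%N)
    (f : (d.-1).-tuple R -> R -> R)
    (hf : forall n, (n <= N)%N ->
       (fun x => f x (n%:R * dt)) \in Lfun (lebesgue_tuple R d.-1) 2%:E)
    (hf0 : forall x, f x 0 = 0)
    (sigma : nat -> (d.-1).-tuple R -> R)
    (hsigma : forward_euler_robin kappa dt N f sigma) :
  (l2L2norm N sigma <=
   (2 / (1 - c * Num.sqrt h))%:E *
   l2L2norm N (fun n x => f x (n%:R * dt)%R))%E.

Proof.
have pi0 : 0 < pi :> R := pi_gt0 R.
have q2 : Num.sqrt 2 ^+ 2 = 2 :> R by rewrite sqr_sqrtr.
have c0 : 0 < c.
  have : 0 <= Num.sqrt 2 :> R by rewrite sqrtr_ge0.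
  by rewrite hc; move: q2; move: (Num.sqrt 2) => q; nra.
have hE : kappa / Num.sqrt pi * Num.sqrt dt = Num.sqrt h.
  rewrite hh; move: (pi) pi0 => p p0.
  have k20 := sqr_ge0 kappa; have kd0 := mulr_ge0 k20 (ltW hdt0).
  rewrite (sqrtrM _ kd0) (sqrtrM _ k20).
  by rewrite sqrtr_sqr gtr0_norm// sqrtrV ?(ltW p0)//; ring.
(* After squaring this is c^2 h < 1, the restriction on the step size. *)
have e0 : 0 < 1 - c * Num.sqrt h.
  rewrite subr_gt0 -(@ltr_pXn2r _ 2) ?nnegrE ?mulr_ge0 ?sqrtr_ge0 ?(ltW c0)//.
  move: hdt; rewrite hh; move: (pi) pi0 => p p0 hd'.
  rewrite expr1n exprMn sqr_sqrtr; last first.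
    by rewrite divr_ge0 ?mulr_ge0 ?sqr_ge0 ?ltW.
  move: hd'; rewrite ltr_pdivlMr ?mulr_gt0 ?exprn_gt0// => hd'.
  by rewrite mulrA ltr_pdivrMr// mul1r; lra.
set e := 1 - c * Num.sqrt h in e0 *.
pose F k (x : (d.-1).-tuple R) := f x (k%:R * dt).
have F2 k : (k <= N)%N -> L2 (sflebesgue R d.-1) (F k).
  move=> kN; have hk := hf k kN; split; last exact: Lfun2_integrable_sqr hk.
  by move: hk; rewrite inE => /andP[+ _]; rewrite inE.
have s2 k : (k <= N)%N -> L2 (sflebesgue R d.-1) (sigma k).
  exact: (forward_euler_L2 hdt0 F2 hsigma).
pose Q := \sum_(k < N.+1) ip (sflebesgue R d.-1) (F k) (F k).
rewrite (l2L2normE s2) (_ : l2L2norm N _ = (Num.sqrt Q)%:E); last first.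
  exact: l2L2normE F2.
rewrite -EFinM lee_fin.
have := forward_euler_energy hkappa hdt0 F2 hsigma.
rewrite hE -hc -/e.
set S := \sum_(k < N.+1) ip _ (sigma k) (sigma k).
set X := \sum_(k < N.+1) ip _ _ (F k).
move=> energy.
have S0 : 0 <= S by apply: sumr_ge0 => k _; exact: ip_ge0.
have Q0 : 0 <= Q by apply: sumr_ge0 => k _; exact: ip_ge0.
apply: (sqrt_absorb e0 S0 Q0 energy).
rewrite /X /S /Q !mulr_sumr -!sumrMnl -big_split/=; apply: ler_sum => k _.
by apply: ip_young; [apply: s2|apply: F2]; rewrite -ltnS.
Qed.
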